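(* For each $c\in\mathbb N$ let $M^{(c)}=(M_{ji}^{(c)}:(j,i)\in\mathcal K)$ be the stationary vector of numbers of packets of each route at each queue in the queueing system at congestion level $c$, with congestion windows given by $G_i^{(c)}(k)=cG_i\big(\frac kc+\frac{d_i^{(c)}}c\big)$, $i\in\mathcal I$. Let $(\Lambda_i^*:i\in\mathcal I)$ be the optimal solution of the system problem: maximize $\sum_{i\in\mathcal I}U_i(\Lambda_i)$ subject to $\sum_{i:\,j\in i}\Lambda_i\le C_j$ for $j\in\mathcal J$, over $\Lambda_i\ge0$, $i\in\mathcal I$. Let $$\mathcal M=\Big\{m\in\mathbb R_+^K:\ m_{ji}C_j=m_j\Lambda_i^*,\ (j,i)\in\mathcal K;\quad G_i'(\bar m_i)=\log\Lambda_i^*,\ i\in\mathcal I\Big\},$$ where $m_j=\sum_{i:j\in i}m_{ji}$ and $\bar m_i=\sum_{j\in i}m_{ji}$. Then for every $\epsilon>0$, $$\mathbb P\Big(\inf_{m\in\mathcal M}\Big\|\frac{M^{(c)}}{c}-m\Big\|\ge\epsilon\Big)\longrightarrow0\qquad\text{as } c\to\infty,$$ where $\|\cdot\|$ is the Euclidean norm.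
   Context: **Network.** $\mathcal J$ is a finite set of queues. $\mathcal I$ is a finite set of routes, each route $i\in\mathcal I$ being a non-empty subset of $\mathcal J$ together with an ordering $(j_1^i,\dots,j_{k_i}^i)$ of its elements. $\mathcal K=\{(j,i)\in\mathcal J\times\mathcal I: j\in i\}$, $K=|\mathcal K|$. Each queue $j$ has capacity $C_j\in(0,\infty)$. For each queue $j$ and $n\ge1$, $(\gamma_j(l,n))_{l=1}^n$ and $(\delta_j(l,n))_{l=1}^n$ are probability vectors (service proportions and insertion probabilities of positions). **Queueing system at congestion level $c$.** A state is $s=(s^j:j\in\mathcal J)$, where $s^j=(i^j_1,\dots,i^j_{m_j})$ is a finite word of routes $i\ni j$ (the routes of the packets in positions $1,\dots,m_j$ of queue $j$). Let $m_{ji}$ be the number of occurrences of $i$ in $s^j$, so $m_j=\sum_{i:j\in i}m_{ji}$, and let $\bar m_i=\sum_{j\in i}m_{ji}$ (the state of congestion window $i$). The system is the continuous-time Markov chain with the following transitions (rates of different events leading to the same state are added): - injection: for each route $i$, with $j=j_1^i$ and $l=1,\dots,m_j+1$, a route $i$ packet is inserted in position $l$ of queue $j$ (packets in positions $l,\dots,m_j$ move to $l+1,\dots,m_j+1$) at rate $g_i^{(c)}(\bar m_i)\,\delta_j(l,m_j+1)$; - transfer: if $i^j_l=i$, $j=j^i_k$, $j'=j^i_{k+1}$, $1\le k\le k_i-1$, the packet in position $l$ of queue $j$ leaves (packets in positions $l+1,\dots,m_j$ move to $l,\dots,m_j-1$) and is inserted in position $l'\in\{1,\dots,m_{j'}+1\}$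 of queue $j'$ at rate $C_j\gamma_j(l,m_j)\,\delta_{j'}(l',m_{j'}+1)$; - acknowledgement: if $i^j_l=i$ and $j=j^i_{k_i}$, the packet in position $l$ of queue $j$ leaves the system at rate $C_j\gamma_j(l,m_j)$. Here $g_i^{(c)}(k)=e^{G_i^{(c)}(k+1)-G_i^{(c)}(k)}$ for $k\in\mathbb Z_+$. Stationary means started from its stationary distribution; $M^{(c)}$ is the vector of counts $m_{ji}$ under the stationary distribution. **Utilities and congestion windows.** For each $i$, $U_i$ is an increasing, strictly concave, differentiable real function on $(0,\infty)$ with $U_i'(\Lambda)\to\infty$ as $\Lambda\to0$ (and $U_i(0)=\lim_{\Lambda\downarrow0}U_i(\Lambda)\in[-\infty,\infty)$). Define $G_i:\mathbb R_+\to[-\infty,\infty)$ by $$-G_i(\bar m_i)=\sup_{\lambda_i\in\mathbb R}\{U_i(e^{\lambda_i})-\bar m_i\lambda_i\}.$$ Assumption 1: $\lambda\mapsto U_i(e^\lambda)$ is strictly concave on $\mathbb R$. Assumption 2: $G_i$ is strictly concave, continuously differentiable on $(0,\infty)$, with derivative taking all values in $\mathbb R$. The condition $G_i'(\bar m_i)=\log\Lambda_i^*$ is understood to require $\bar m_i>0$. For each $i$, $(d_i^{(c)})_{c\in\mathbb N}$ is a bounded real sequence such that $G_i^{(c)}(k)=cG_i\big(\frac kc+\frac{d_i^{(c)}}c\big)$ is defined and finite for all $k\in\mathbb Z_+$. *)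

(* Defs.v *)
From HB Require Import structures.
From mathcomp Require Import all_boot all_order all_algebra.
From mathcomp Require Import all_classical all_reals all_analysis.

Set Implicit Arguments.
Unset Strict Implicit.
Unset Printing Implicit Defensive.

Import Order.TTheory GRing.Theory Num.Theory.
Import numFieldNormedType.Exports.

Local Open Scope classical_set_scope.
Local Open Scope ring_scope.

(* Positions in a queue are numbered from 0: [gamma j l n] and [delta j l n]
   stand for gamma_j(l+1, n) and delta_j(l+1, n), and only l < n matters.
   Routes form a set, hence the injectivity of the indexing [route]. *)
Record network (R : realType) (J I : finType) := Network {
  route : I -> seq J;
  route_inj : injective route;
  route_neq0 : forall i, route i != [::];
  route_uniq : forall i, uniq (route i);
  cap : J -> R;
  cap_gt0 : forall j, 0 < cap j;
  gamma : J -> nat -> nat -> R;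
  gamma_ge0 : forall j n l, (l < n)%N -> 0 <= gamma j l n;
  gamma_sum1 : forall j n, (0 < n)%N -> \sum_(l < n) gamma j l n = 1;
  delta : J -> nat -> nat -> R;
  delta_ge0 : forall j n l, (l < n)%N -> 0 <= delta j l n;
  delta_sum1 : forall j n, (0 < n)%N -> \sum_(l < n) delta j l n = 1
}.

Section Queueing.
Context (R : realType) (J I : finType) (N : network R J I).

(* [index j (route N i)] is the (0-based) rank of queue j on route i. *)
Definition is_first (i : I) (j : J) : bool :=
  (j \in route N i) && (index j (route N i) == 0%N).

Definition is_next (i : I) (j j' : J) : bool :=
  [&& j \in route N i, j' \in route N i &
      index j' (route N i) == (index j (route N i)).+1].

Definition is_last (i : I) (j : J) : bool :=
  (j \in route N i) && ((index j (route N i)).+1 == size (route N i)).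

Definition words : Type := {ffun J -> seq I}.

Definition state : countType :=
  {s : {ffun J -> seq I} | [forall j, all (fun i => j \in route N i) (s j)]}.

Definition word (s : state) (j : J) : seq I := sval s j.

Definition insert_at (l : nat) (i : I) (w : seq I) : seq I :=
  take l w ++ i :: drop l w.

Definition remove_at (l : nat) (w : seq I) : seq I :=
  take l w ++ drop l.+1 w.

Definition insert_packet (s : words) (j : J) (l : nat) (i : I) : words :=
  [ffun j' => if j' == j then insert_at l i (s j) else s j'].

Definition remove_packet (s : words) (j : J) (l : nat) : words :=
  [ffun j' => if j' == j then remove_at l (s j) else s j'].

Definition queue_route_count (s : state) (j : J) (i : I) : nat :=
  count_mem i (word s j).

Definition window_count (s : state) (i : I) : nat :=
  (\sum_(j in route N i) queue_route_count s j i)%N.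

(* Each sum ranges over the individual events and adds the rates of those
   leading from s to s'; [onth (word s j) l == Some i] says that the packet in
   position l of queue j has route i. *)
Definition injection_rate (g : I -> nat -> R) (s s' : state) : R :=
  \sum_i \sum_(j | is_first i j) \sum_(l < (size (word s j)).+1)
    if sval s' == insert_packet (sval s) j l i
    then g i (window_count s i) * delta N j l (size (word s j)).+1
    else 0.

Definition transfer_rate (s s' : state) : R :=
  \sum_i \sum_j \sum_(j' | is_next i j j')
  \sum_(l < size (word s j) | onth (word s j) l == Some i)
  \sum_(l' < (size (word s j')).+1)
    if sval s' == insert_packet (remove_packet (sval s) j l) j' l' i
    then cap N j * gamma N j l (size (word s j))
         * delta N j' l' (size (word s j')).+1
    else 0.

Definition ack_rate (s s' : state) : R :=
  \sum_i \sum_(j | is_last i j)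
  \sum_(l < size (word s j) | onth (word s j) l == Some i)
    if sval s' == remove_packet (sval s) j l
    then cap N j * gamma N j l (size (word s j))
    else 0.

Definition queueing_rate (g : I -> nat -> R) (s s' : state) : R :=
  injection_rate g s s' + transfer_rate s s' + ack_rate s s'.

(* The index set K of pairs (j, i) with j on route i, and vectors in R^K. *)
Definition incidence : finType := {p : J * I | p.1 \in route N p.2}.

Definition count_vector (s : state) : {ffun incidence -> R} :=
  [ffun k => (queue_route_count s (sval k).1 (sval k).2)%:R].

Definition queue_total (m : {ffun incidence -> R}) (j : J) : R :=
  \sum_(k : incidence | (sval k).1 == j) m k.

Definition window_total (m : {ffun incidence -> R}) (i : I) : R :=
  \sum_(k : incidence | (sval k).2 == i) m k.

Definition enorm (m : {ffun incidence -> R}) : R :=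
  Num.sqrt (\sum_k m k ^+ 2).

(* The infimum over the empty set is +oo. *)
Definition dist_to (A : set {ffun incidence -> R}) (x : {ffun incidence -> R})
    : \bar R :=
  ereal_inf [set (enorm [ffun k => x k - m k])%:E | m in A].

End Queueing.

(* Equilibrium equations pi Q = 0 of the continuous-time Markov chain with
   off-diagonal jump rates q on a countable state space. For the queueing
   system the total rate out of a state is bounded (g_i is nonincreasing
   because G_i is concave), so the chain does not explode. *)
Definition is_stationary (R : realType) (S : countType) (q : S -> S -> R)
    (pi : S -> R) : Prop :=
  [/\ forall s, 0 <= pi s,
      \esum_(s in [set: S]) (pi s)%:E = 1%E &
      forall s,
        \esum_(s' in [set s' | s' != s]) (pi s * q s s')%:E
        = \esum_(s' in [set s' | s' != s]) (pi s' * q s' s)%:E].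

Definition pmf_prob (R : realType) (S : countType) (pi : S -> R) (A : set S)
    : \bar R :=
  \esum_(s in A) (pi s)%:E.

Section Utilities.
Context (R : realType).
Implicit Types U : R -> R.

Definition strictly_concave_on (D : set R) (f : R -> R) : Prop :=
  forall x y t, D x -> D y -> x != y -> 0 < t < 1 ->
    t * f x + (1 - t) * f y < f (t * x + (1 - t) * y).

(* A utility is only meaningful on (0, +oo); its values elsewhere are junk. *)
Record is_utility U : Prop := IsUtility {
  utility_incr : forall x y : R, 0 < x -> x < y -> U x < U y;
  utility_concave : strictly_concave_on [set x | 0 < x] U;
  utility_derivable : forall x : R, 0 < x -> derivable U x 1;
  utility_derive0 : (U^`()%classic) x @[x --> 0^'+] --> +oo
}.

Definition utility_ext U (x : R) : \bar R :=
  if 0 < x then (U x)%:E else lim ((U y)%:E @[y --> 0^'+]).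

Definition window_fun_ext U (m : R) : \bar R :=
  (- ereal_sup [set (U (expR lam) - m * lam)%:E | lam in [set: R]])%E.

(* Real-valued version, meaningful where [window_fun_ext] is finite. *)
Definition window_fun U (m : R) : R := fine (window_fun_ext U m).

Definition assumption1 U : Prop :=
  strictly_concave_on [set: R] (fun lam => U (expR lam)).

Record assumption2 U : Prop := Assumption2 {
  window_fin : forall m : R, 0 < m -> window_fun_ext U m \is a fin_num;
  window_concave : strictly_concave_on [set m | 0 < m] (window_fun U);
  window_derivable : forall m : R, 0 < m -> derivable (window_fun U) m 1;
  window_C1 : forall m : R, 0 < m ->
    {for m, continuous (window_fun U)^`()%classic};
  window_surj : forall y : R,
    exists2 m : R, 0 < m & (window_fun U)^`()%classic m = y
}.

Definition scaled_arg (c : nat) (d : R) (k : nat) : R :=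
  k%:R / c%:R + d / c%:R.

(* G^(c)(k) and g^(c)(k); used for c > 0 only. *)
Definition scaled_window_fun U (c : nat) (d : R) (k : nat) : R :=
  c%:R * window_fun U (scaled_arg c d k).

Definition injection_fun U (c : nat) (d : R) (k : nat) : R :=
  expR (scaled_window_fun U c d k.+1 - scaled_window_fun U c d k).

(* "Defined" means that the argument lies in the domain [0, +oo) of G. *)
Definition scaled_window_defined U (c : nat) (d : R) : Prop :=
  forall k, 0 <= scaled_arg c d k /\
    window_fun_ext U (scaled_arg c d k) \is a fin_num.

End Utilities.

Section SystemProblem.
Context (R : realType) (J I : finType) (N : network R J I) (U : I -> R -> R).

Definition feasible (L : I -> R) : Prop :=
  (forall i, 0 <= L i) /\
  (forall j, \sum_(i | j \in route N i) L i <= cap N j).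

Definition system_objective (L : I -> R) : \bar R :=
  (\sum_i utility_ext (U i) (L i))%E.

Definition system_optimal (L : I -> R) : Prop :=
  feasible L /\
  forall L', feasible L' -> (system_objective L' <= system_objective L)%E.

Definition limit_set (L : I -> R) : set {ffun incidence N -> R} :=
  [set m : {ffun incidence N -> R} |
    [/\ forall k, 0 <= m k,
        forall k : incidence N, m k * cap N (sval k).1
                  = queue_total m (sval k).1 * L (sval k).2 &
        forall i, 0 < window_total m i /\
          (window_fun (U i))^`()%classic (window_total m i) = ln (L i)]].

End SystemProblem.

Arguments queueing_rate {R J I} N g s s'.
Arguments limit_set {R J I} N U L.

(* Main.v *)
Require Import Defs.
From mathcomp Require Import all_boot all_order all_algebra.
From mathcomp Require Import all_classical all_reals all_analysis.
From mathcomp Require Import ring lra.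
Import Order.TTheory GRing.Theory Num.Theory.
Import numFieldNormedType.Exports.
Local Open Scope classical_set_scope.
Local Open Scope ring_scope.

Set Implicit Arguments.
Unset Strict Implicit.
Unset Printing Implicit Defensive.

(** The measure with weight [exp (sum_i G_i(window_i))] times the product over
    the packets of [1 / C_j] is stationary (the queues are quasi-reversible).
    Stationary distributions are unique: the set where one exceeds another is
    closed under the jumps, hence contains the empty system, which services
    alone can reach from every state.

    Let [L] be the optimum and [f_i(y) = G_i(y) - y ln L_i + U_i(L_i)], a concave
    function with maximum [0] at [x_i = L_i U_i'(L_i)].  Up to a constant the
    weight is [exp (c sum_i f_i)] times the probability that every packet at
    queue [j] chooses its route independently, route [i] with probability
    [L_i / C_j].  Chernoff bounds make the weight of window sizes away from
    [c x_i], and of route proportions away from [L_i / C_j], exponentially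
    small.  The normalising constant is not exponentially small: by the KKT
    conditions [U_i'(L_i)] is a sum of prices [q_j] of saturated queues, and
    queue lengths close to [c q_j C_j] carry enough weight.  A compactness
    argument turns these approximate equations into closeness to the limit
    set. *)

(** * Uniqueness of stationary distributions *)

(** At a saturated queue the fractions [L_i / C_j] sum to exactly 1, so the independent choice of
    routes alone has infinite total mass: summability must come from the gaps [f_i], which fall at
    least linearly at infinity. Summed over the routes they give a factor
    [exp (- theta * population)] at the price of [exp (theta * c * B)], with [B] a constant, and
    [theta] is taken so small that this price stays below what the event under study gains. The
    decay per packet makes each queue a convergent geometric series and also pays for the
    second-order cost of a Chernoff tilt; deviations of route counts can thus be measured against
    [c] whatever the queue length. The prices [q_j] need not be unique, so only the distance to a
    set is controlled. They explain its shape: with [q_j = m_j / C_j] its equations read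
    [m_ji = q_j L_i], and summing along a route gives [L_i U_i'(L_i) = x_i]. *)

Lemma fin_addeI (R : realDomainType) (x y z : \bar R) :
  x \is a fin_num -> (x + y = x + z)%E -> y = z.
Proof.
by case: x => // x _; case: y => [y| |]; case: z => [z| |] //= [/addrI ->].
Qed.

Lemma esum_subset (R : realType) (T : choiceType) (A B : set T)
    (a : T -> \bar R) :
  A `<=` B -> (\esum_(i in A) a i <= \esum_(i in B) a i)%E.
Proof.
move=> AB; apply: ge_ereal_sup => _ [X [fX XA] <-].
by apply: ereal_sup_ubound; exists X => //; split => // x /XA /AB.
Qed.

Lemma esum_term_le (R : realType) (T : choiceType) (D : set T)
    (a : T -> \bar R) (t : T) :
  D t -> (0 <= a t)%E -> (a t <= \esum_(i in D) a i)%E.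
Proof.
move=> Dt at0; rewrite -(esum_set1 at0); apply: esum_subset.
by move=> x ->.
Qed.

Lemma le_esumZl (R : realType) (T : choiceType) (D : set T) (c : R)
    (a : T -> R) : 0 <= c -> (forall i, 0 <= a i) ->
  (\esum_(i in D) (c * a i)%:E <= c%:E * \esum_(i in D) (a i)%:E)%E.
Proof.
move=> c0 a0; apply: ge_ereal_sup => _ [X [fX XD] <-].
have -> : (\sum_(i \in X) (c * a i)%:E = c%:E * \sum_(i \in X) (a i)%:E)%E.
  rewrite !fsbig_finite//= ge0_sume_distrr; first by apply: eq_bigr => i _; rewrite EFinM.
  by move=> i _; rewrite lee_fin.
apply: lee_wpmul2l; first by rewrite lee_fin.
by apply: ereal_sup_ubound; exists X.
Qed.

Lemma esumZl (R : realType) (T : choiceType) (D : set T) (c : R)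
    (a : T -> R) : 0 <= c -> (forall i, 0 <= a i) ->
  (\esum_(i in D) (c * a i)%:E = c%:E * \esum_(i in D) (a i)%:E)%E.
Proof.
move=> c0 a0; apply/eqP; rewrite eq_le le_esumZl//=.
have [->|cn0] := eqVneq c 0.
  by rewrite mul0e; apply: esum_ge0 => i _; rewrite mul0r.
have {}c0 : 0 < c by rewrite lt_def cn0.
rewrite -lee_pdivlMl//.
have -> : (\esum_(i in D) (a i)%:E = \esum_(i in D) (c^-1 * (c * a i))%:E)%E.
  by apply: eq_esum => i _; rewrite mulKf ?gt_eqF.
by apply: le_esumZl => [|i]; rewrite ?invr_ge0 ?mulr_ge0// ltW.
Qed.

Lemma esum_eq_pointwise (R : realType) (T : choiceType)
    (a b : T -> \bar R) :
  (forall i, 0 <= a i)%E -> (forall i, a i <= b i)%E ->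
  (\esum_(i in setT) b i < +oo)%E ->
  (\esum_(i in setT) a i = \esum_(i in setT) b i)%E -> forall i, a i = b i.
Proof.
move=> a0 ab bfin eqab i.
have b0 j : (0 <= b j)%E by exact: le_trans (a0 j) (ab j).
have bf j : b j \is a fin_num.
  rewrite ge0_fin_numE//; apply: le_lt_trans bfin; exact: (@esum_term_le _ _ setT b j).
have af j : a j \is a fin_num.
  by rewrite ge0_fin_numE//; apply: le_lt_trans (ab j) _; rewrite -ge0_fin_numE.
have d0 j : (0 <= b j - a j)%E by rewrite sube_ge0 ?ab// af.
have : (\esum_(i in setT) b i =
    \esum_(i in setT) a i + \esum_(i in setT) (b i - a i))%E.
  rewrite -esumD//; apply: eq_esum => j _.
  by rewrite addeC subeK ?af.
rewrite -eqab -[in LHS](adde0 (esum _ a)) => /esym e.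
have sf : \esum_(i in setT) a i \is a fin_num.
  by rewrite ge0_fin_numE ?eqab// ; apply: esum_ge0.
have {e} e0 := fin_addeI sf e.
have := @esum_term_le _ _ setT (fun j => b j - a j)%E i Logic.I (d0 i).
rewrite e0 => di; have : (b i - a i = 0)%E by apply/eqP; rewrite eq_le di d0.
by move=> /eqP; rewrite sube_eq ?add0e ?af ?fin_num_adde_defl// => /eqP.
Qed.

Section StationaryUniqueness.
Context (R : realType) (S : countType) (q : S -> S -> R).
Hypothesis q_ge0 : forall s s', 0 <= q s s'.

Definition inflow (f : S -> R) (s : S) : \bar R :=
  \esum_(s' in [set s' | s' != s]) (f s' * q s' s)%:E.

Definition outflow (f : S -> R) (s : S) : \bar R :=
  \esum_(s' in [set s' | s' != s]) (f s * q s s')%:E.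

Lemma inflow_ge0 f s : (forall s, 0 <= f s) -> (0 <= inflow f s)%E.
Proof. by move=> f0; apply: esum_ge0 => t _; rewrite lee_fin mulr_ge0. Qed.

Lemma le_inflow f g s :
  (forall s, f s <= g s) -> (inflow f s <= inflow g s)%E.
Proof. by move=> fg; apply: le_esum => t _; rewrite lee_fin ler_wpM2r. Qed.

(** Both sides are the total flow over ordered pairs of distinct states; the reindexing swaps the
    two ends of a jump. *)
Lemma esum_inflow f : (forall s, 0 <= f s) ->
  (\esum_(s in setT) inflow f s = \esum_(s in setT) outflow f s)%E.
Proof.
move=> f0; rewrite /inflow /outflow.
rewrite (@esum_esum R S S setT (fun s => [set s' | s' != s])
   (fun s s' => (f s' * q s' s)%:E)); last by move=> *; rewrite lee_fin mulr_ge0.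
rewrite (@esum_esum R S S setT (fun s => [set s' | s' != s])
   (fun s s' => (f s * q s s')%:E)); last by move=> *; rewrite lee_fin mulr_ge0.
rewrite (reindex_esum (setT `*`` (fun s : S => [set s' | s' != s]))
  _ (fun x => (x.2, x.1)))//; split=> //=.
- by move=> [i j] [_ /=]; rewrite eq_sym.
- by move=> [i1 i2] [j1 j2] _ _ [-> ->].
- move=> [i j] [_ /= ij]; exists (j, i) => //; split => //=; by rewrite eq_sym.
Qed.

(** The minimum [nu] has inflow at most outflow at every state; the two totals agree and are finite,
    so equality holds everywhere. If [pi] did not exceed [mu] at [s'], then [nu] and [pi] would have
    the same inflow there, hence agree at every state that jumps to [s'], [s] included. *)
Lemma stationary_propagate pi mu s s' :
  (forall s, 0 <= pi s) -> (forall s, 0 <= mu s) ->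
  (forall s, outflow pi s = inflow pi s) ->
  (forall s, outflow mu s = inflow mu s) ->
  (\esum_(s in setT) outflow mu s < +oo)%E ->
  s' != s -> 0 < q s s' -> mu s < pi s -> mu s' < pi s'.
Proof.
move=> pi0 mu0 Hpi Hmu fin ss' qss' lt_s.
pose nu s := Num.min (pi s) (mu s).
have nu0 t : 0 <= nu t by rewrite le_min pi0 mu0.
have nupi t : nu t <= pi t by rewrite ge_min lexx.
have numu t : nu t <= mu t by rewrite ge_min lexx orbT.
have nuio t : (inflow nu t <= outflow nu t)%E.
  have [h|h] := leP (pi t) (mu t).
  - have -> : outflow nu t = outflow pi t by rewrite /outflow /nu min_l.
    by rewrite Hpi; exact: le_inflow.
  - have -> : outflow nu t = outflow mu t by rewrite /outflow /nu min_r// ltW.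
    by rewrite Hmu; exact: le_inflow.
have nufin : (\esum_(s in setT) outflow nu s < +oo)%E.
  apply: le_lt_trans fin; apply: le_esum => t _; apply: le_esum => u _.
  by rewrite lee_fin ler_wpM2r.
have E := @esum_eq_pointwise _ _ (inflow nu) (outflow nu)
  (fun t => inflow_ge0 t nu0) nuio nufin (esum_inflow nu0).
rewrite ltNge; apply/negP => le_s'.
have : inflow nu s' = inflow pi s'.
  by rewrite E -Hpi /outflow /nu min_l.
have nuf : inflow nu s' \is a fin_num.
  rewrite ge0_fin_numE ?inflow_ge0// E; apply: le_lt_trans nufin.
  apply: (@esum_term_le _ _ setT (outflow nu)) => //.
  by rewrite -E; exact: inflow_ge0.
have -> : inflow pi s' = (inflow nu s' + inflow (fun t => pi t - nu t)%R s')%E.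
  rewrite /inflow -esumD; first by apply: eq_esum => t _; rewrite -EFinD -mulrDl addrC subrK.
  - by move=> t _; rewrite lee_fin mulr_ge0.
  - by move=> t _; rewrite lee_fin mulr_ge0// subr_ge0.
rewrite -[in LHS](adde0 (inflow nu s')) => /(fin_addeI nuf) e0.
have : ((((pi s - nu s) * q s s')%:E : \bar R)%E <= 0%E)%E.
  rewrite e0; apply: (@esum_term_le _ _ _ (fun t => ((pi t - nu t) * q t s')%:E)).
    by rewrite /= eq_sym.
  by rewrite lee_fin mulr_ge0// subr_ge0.
rewrite lee_fin leNgt mulr_gt0// subr_gt0 /nu min_r//; exact: ltW.
Qed.

(* The minimum of two stationary measures is stationary, so the set where one
   of them exceeds the other is closed under the jumps of the chain. *)
Lemma stationary_unique pi mu (z : S) :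
  is_stationary q pi -> is_stationary q mu ->
  (\esum_(s in setT) outflow pi s < +oo)%E ->
  (\esum_(s in setT) outflow mu s < +oo)%E ->
  (forall P : S -> Prop,
    (forall s s', s' != s -> 0 < q s s' -> P s -> P s') ->
    forall s, P s -> P z) ->
  pi = mu.
Proof.
move=> [pi0 pi1 Hpi] [mu0 mu1 Hmu] fpi fmu reach.
have F1 s : mu s < pi s -> mu z < pi z.
  apply: (reach (fun s => mu s < pi s)) => t t' tt' qt.
  exact: stationary_propagate.
have F2 s : pi s < mu s -> pi z < mu z.
  apply: (reach (fun s => pi s < mu s)) => t t' tt' qt.
  exact: stationary_propagate.
have H (f g : S -> R) : (forall s, 0 <= f s) -> (forall s, f s <= g s) ->
    (\esum_(s in setT) (f s)%:E = 1%E)%E ->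
    (\esum_(s in setT) (g s)%:E = 1%E)%E -> f = g.
  move=> f0 fg f1 g1; apply/funext => s.
  have := @esum_eq_pointwise _ _ (fun s => (f s)%:E) (fun s => (g s)%:E).
  have h1 : forall i, (0 <= (f i)%:E)%E by move=> i; rewrite lee_fin.
  have h2 : forall i, ((f i)%:E <= (g i)%:E)%E by move=> i; rewrite lee_fin.
  have h3 : (\esum_(s in setT) (g s)%:E < +oo)%E by rewrite g1 ltry.
  by move=> /(_ h1 h2 h3); rewrite f1 g1 => /(_ erefl s) [].
(* If [pi] exceeds [mu] nowhere, equal total mass forces equality. Otherwise [pi] exceeds [mu] at
   [z], and by [F2] [mu] exceeds [pi] nowhere. *)
have [N1|/existsNP[s /contrapT /F1 ltz]] := pselect (forall s, ~ mu s < pi s).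
  by apply: H => // s; rewrite leNgt; apply/negP/N1.
apply/esym/H => // t; rewrite leNgt; apply/negP => /F2.
by rewrite ltNge (ltW ltz).
Qed.

End StationaryUniqueness.

(** * Events of the queueing system *)

Lemma onth_insert_at (I : finType) l (i : I) w :
  (l <= size w)%N -> onth (insert_at l i w) l = Some i.
Proof. by move=> lw; rewrite onth_cat size_takel// ltnn subnn. Qed.

Lemma size_insert_at (I : finType) l (i : I) w :
  size (insert_at l i w) = (size w).+1.
Proof. by rewrite size_cat /= addnS -size_cat cat_take_drop. Qed.

Lemma insert_atK (I : finType) l (i : I) w :
  (l <= size w)%N -> remove_at l (insert_at l i w) = w.
Proof.
move=> lw; rewrite /remove_at /insert_at take_cat drop_cat size_takel// ltnn.
by rewrite subnn take0 cats0 ltnNge leqnSn /= subSn// subnn /= drop0 cat_take_drop.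
Qed.

Lemma remove_atK (I : finType) l (i : I) w :
  onth w l = Some i -> insert_at l i (remove_at l w) = w.
Proof.
move=> wl; have lw : (l < size w)%N by rewrite -onthTE wl.
rewrite /remove_at /insert_at take_cat drop_cat size_takel ?(ltnW lw)// ltnn.
rewrite subnn take0 cats0 drop0 -[X in X :: _](onth_nth i i w l wl) -drop_nth//.
by rewrite cat_take_drop.
Qed.

Lemma perm_insert_at (I : finType) l (i : I) w :
  perm_eq (insert_at l i w) (i :: w).
Proof. by rewrite /insert_at -(cat1s i (drop l w)) perm_catCA cat_take_drop. Qed.

Lemma size_remove_at (I : finType) l (w : seq I) :
  (l < size w)%N -> (size (remove_at l w)).+1 = size w.
Proof.
move=> lw; rewrite /remove_at size_cat size_takel ?(ltnW lw)// size_drop.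
by rewrite -addnS subnSK// subnKC// ltnW.
Qed.

(** The range of positions depends on the queue length, which differs before and after a jump; the
    bounds are therefore treated as part of the condition. *)
Lemma sum_ord_reindex (R : nmodType) (a b : nat) (P Q : pred nat)
    (F H : nat -> R) :
  (forall l, (l < a)%N && P l = (l < b)%N && Q l) ->
  (forall l, (l < b)%N -> Q l -> F l = H l) ->
  \sum_(l < a | P l) F l = \sum_(l < b | Q l) H l.
Proof.
move=> PQ FH.
rewrite (big_ord_widen_cond _ P F (leq_maxl a b)).
rewrite (big_ord_widen_cond _ Q H (leq_maxr a b)).
apply: eq_big => [l|l]; first by rewrite andbC PQ andbC.
by rewrite andbC PQ => /andP[]; exact: FH.
Qed.

Lemma sum_ord_exchange (R : nmodType) (a b a' b' : nat)
    (P P' : pred nat) (Q Q' : nat -> nat -> bool) (F H : nat -> nat -> R) :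
  (forall l k, [&& (l < a)%N, P l, (k < b)%N & Q l k] =
               [&& (k < a')%N, P' k, (l < b')%N & Q' k l]) ->
  (forall l k, [&& (l < a)%N, P l, (k < b)%N & Q l k] -> F l k = H k l) ->
  \sum_(l < a | P l) \sum_(k < b | Q l k) F l k =
  \sum_(k < a' | P' k) \sum_(l < b' | Q' k l) H k l.
Proof.
move=> PQ FH; pose n := maxn (maxn a b) (maxn a' b').
have an : (a <= n)%N by rewrite /n !leq_max leqnn.
have bn : (b <= n)%N by rewrite /n !leq_max leqnn orbT.
have an' : (a' <= n)%N by rewrite /n !leq_max leqnn !orbT.
have bn' : (b' <= n)%N by rewrite /n !leq_max leqnn !orbT.
rewrite (big_ord_widen_cond _ P (fun l => \sum_(k < b | Q l k) F l k) an).
rewrite (big_ord_widen_cond _ P' (fun k => \sum_(l < b' | Q' k l) H k l) an').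
under eq_bigr => l _ do rewrite (big_ord_widen_cond _ (Q l) (F l) bn).
under [RHS]eq_bigr => l _ do rewrite (big_ord_widen_cond _ (Q' l) (H l) bn').
rewrite !pair_big_dep /= (reindex_inj (h := fun p => (p.2, p.1))) /=; last first.
  by move=> [x y] [z t] [-> ->].
apply: eq_big => [[k l]|[k l]] /=.
  by have := PQ l k; do 8?case: (_ < _)%N => //=; do 4?case: (P _) => //=;
    rewrite ?andbF ?andbT //=; case: (Q _ _); case: (P' _) => //=;
    case: (Q' _ _).
move=> /andP[/andP[Pl la] /andP[Qlk kb]]; apply: FH; exact/and4P.
Qed.

Section Packets.
Context (R : realType) (J I : finType) (N : network R J I).
Implicit Types (x y : words J I) (j : J) (l : nat) (i : I) (s : state N).

Definition valid x := [forall j, all (fun i => j \in route N i) (x j)].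

Lemma valid_state s : valid (sval s).
Proof. by case: s. Qed.

Lemma valid_insert x j l i :
  j \in route N i -> valid x -> valid (insert_packet x j l i).
Proof.
move=> ji /forallP vx; apply/forallP => k; rewrite ffunE.
case: eqP => [->|_]; last exact: vx.
by rewrite (perm_all _ (perm_insert_at l i (x j))) /= ji; exact: vx.
Qed.

Lemma valid_remove x j l : valid x -> valid (remove_packet x j l).
Proof.
move=> /forallP vx; apply/forallP => k; rewrite ffunE.
case: eqP => [->|_]; last exact: vx.
have /allP vj := vx j; apply/allP => i; rewrite mem_cat => h; apply: vj.
by case/orP: h => [/mem_take|/mem_drop].
Qed.

Lemma insert_packetK x j l i :
  (l <= size (x j))%N -> remove_packet (insert_packet x j l i) j l = x.
Proof.
by move=> lx; apply/ffunP => k; rewrite !ffunE eqxx insert_atK//; case: eqP => [->|].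
Qed.

Lemma remove_packetK x j l i :
  onth (x j) l = Some i -> insert_packet (remove_packet x j l) j l i = x.
Proof.
by move=> lx; apply/ffunP => k; rewrite !ffunE eqxx remove_atK//; case: eqP => [->|].
Qed.

(** Insertion and removal at a fixed position are mutually inverse. Including the bounds on the
    position turns a sum over jumps into a state into a sum over positions of that state. *)
Lemma insert_packet_eq x y j l i :
  (l < (size (y j)).+1)%N && (x == insert_packet y j l i) =
  (l < size (x j))%N &&
    ((onth (x j) l == Some i) && (y == remove_packet x j l)).
Proof.
apply/idP/idP => [/andP[ly /eqP ->]|/andP[lx /andP[/eqP xl /eqP ->]]].
  by rewrite insert_packetK// eqxx ffunE eqxx size_insert_at onth_insert_at ?ly ?eqxx.
by rewrite remove_packetK// eqxx ffunE eqxx size_remove_at// lx.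
Qed.

(** A transfer is undone by moving the packet back. With the queues exchanged the statement is its
    own converse, so one implication suffices. *)
Lemma transfer_eq_imp x y j j' l l' i : j != j' ->
  [&& (l < size (y j))%N, onth (y j) l == Some i, (l' < (size (y j')).+1)%N &
      x == insert_packet (remove_packet y j l) j' l' i] ->
  [&& (l' < size (x j'))%N, onth (x j') l' == Some i, (l < (size (x j)).+1)%N &
      y == insert_packet (remove_packet x j' l') j l i].
Proof.
move=> jj' /and4P[ly /eqP yl ly' xE].
have := insert_packet_eq x (remove_packet y j l) j' l' i.
rewrite xE [remove_packet _ _ _ j']ffunE eq_sym (negbTE jj') ly' /=.
move=> /esym /andP[lx /andP[xl /eqP <-]].
rewrite lx xl remove_packetK// eqxx (eqP xE) ffunE (negbTE jj') ffunE eqxx.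
by rewrite size_remove_at// ly.
Qed.

Lemma transfer_eq x y j j' l l' i : j != j' ->
  [&& (l < size (y j))%N, onth (y j) l == Some i, (l' < (size (y j')).+1)%N &
      x == insert_packet (remove_packet y j l) j' l' i] =
  [&& (l' < size (x j'))%N, onth (x j') l' == Some i, (l < (size (x j)).+1)%N &
      y == insert_packet (remove_packet x j' l') j l i].
Proof.
by move=> jj'; apply/idP/idP; apply: transfer_eq_imp => //; rewrite eq_sym.
Qed.

Lemma is_next_neq i j j' : is_next N i j j' -> j != j'.
Proof. by move=> /and3P[_ _]; apply: contraTneq => ->; rewrite ltn_eqF. Qed.

End Packets.

(** * Sums of nonnegative families *)

Section HasEsum.
Context (R : realType) (T : choiceType).
Implicit Types (f : T -> R) (v : R).

(** Nonnegativity is bundled with the value because the linearity of [\esum] requires it at each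
    use. *)
Definition has_esum f v : Prop :=
  (forall t, 0 <= f t) /\ (\esum_(t in setT) (f t)%:E = v%:E)%E.

Lemma has_esum_sum (K : finType) (P : pred K) (f : K -> T -> R) (v : K -> R) :
  (forall k, P k -> has_esum (f k) (v k)) ->
  has_esum (fun t => \sum_(k | P k) f k t) (\sum_(k | P k) v k).
Proof.
move=> H; split=> [t|]; first by apply: sumr_ge0 => k /H[].
under eq_esum => t _ do rewrite -sumEFin.
rewrite esum_sum; last by move=> t k _ /H[h _]; rewrite lee_fin.
by rewrite -sumEFin; apply: eq_bigr => k /H[].
Qed.

Lemma has_esumD f g v w :
  has_esum f v -> has_esum g w -> has_esum (fun t => f t + g t) (v + w).
Proof.
move=> [f0 fv] [g0 gw]; split=> [t|]; first by rewrite addr_ge0.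
under eq_esum => t _ do rewrite EFinD.
by rewrite esumD ?fv ?gw// => t _; rewrite lee_fin.
Qed.

Lemma has_esumZl c f v :
  0 <= c -> has_esum f v -> has_esum (fun t => c * f t) (c * v).
Proof.
move=> c0 [f0 fv]; split=> [t|]; first by rewrite mulr_ge0.
by rewrite esumZl// fv EFinM.
Qed.

Lemma has_esum_point (t0 : T) f v : (forall t, t != t0 -> f t = 0) ->
  f t0 = v -> 0 <= v -> has_esum f v.
Proof.
move=> f0 <- v0; split=> [t|].
  by have [->//|/f0 ->] := eqVneq t t0.
rewrite (esumID [set t0]); last first.
  by move=> t _; have [->//|/f0 ->] := eqVneq t t0; rewrite lee_fin.
rewrite setTI esum_set1 ?lee_fin// setTI esum1 ?adde0// => t /= /eqP /f0 ->//.
Qed.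

Lemma eq_has_esum f g v w :
  (forall t, f t = g t) -> v = w -> has_esum g w -> has_esum f v.
Proof. by move=> /funext -> ->. Qed.

End HasEsum.

(** * The product-form weight and the flows through a state *)

Section ProductForm.
Context (R : realType) (J I : finType) (N : network R J I).
Context (G : I -> nat -> R).
Implicit Types (x y : words J I) (j : J) (l : nat) (i : I) (s : state N).

Let g i k := expR (G i k.+1 - G i k).

(** Agrees with [window_count] on states, but lives on raw words so that it applies to the results
    of [insert_packet] and [remove_packet] without a proof of validity; [weight] follows the same
    convention. *)
Definition wcount x i := (\sum_(j in route N i) count_mem i (x j))%N.

Definition weight x : R :=
  expR (\sum_i G i (wcount x i)) * \prod_j (cap N j)^-1 ^+ size (x j).

Lemma weight_gt0 x : 0 < weight x.
Proof.
rewrite mulr_gt0 ?expR_gt0// prodr_gt0// => j _.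
by rewrite exprn_gt0// invr_gt0 cap_gt0.
Qed.

Lemma wcount_insert x j l i i' : j \in route N i ->
  wcount (insert_packet x j l i) i' = ((i' == i) + wcount x i')%N.
Proof.
move=> ji; rewrite /wcount.
have -> : (\sum_(k in route N i') count_mem i' (insert_packet x j l i k) =
  \sum_(k in route N i') (((k == j) && (i == i')) + count_mem i' (x k)))%N.
  apply: eq_bigr => k _; rewrite ffunE; case: eqP => [->|//].
  by rewrite (permP (perm_insert_at l i (x j))).
rewrite big_split /=; congr addn.
have [->|ii'] := eqVneq i' i; last by rewrite big1// => k _; rewrite andbF.
by rewrite (bigD1 j) ?ji//= eqxx big1 // => k /andP[_ /negbTE ->].
Qed.

(** Only window [i] moves, by one step, which contributes exactly the injection rate; the queue
    contributes [1 / cap N j]. The position does not matter, which is why the weight involves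
    neither [gamma] nor [delta]. *)
Lemma weight_insert x j l i : j \in route N i ->
  weight (insert_packet x j l i) = weight x * (g i (wcount x i) / cap N j).
Proof.
move=> ji; rewrite /weight /g mulrACA -expRD; congr (_ * _).
  congr expR; rewrite [in LHS](bigD1 i)//= [in RHS](bigD1 i)//=.
  rewrite wcount_insert// eqxx add1n addrAC addrCA subrr addr0; congr +%R.
  by apply: eq_bigr => k /negbTE ki; rewrite wcount_insert// ki.
rewrite [in LHS](bigD1 j)//= [in RHS](bigD1 j)//= ffunE eqxx size_insert_at.
rewrite exprS [RHS]mulrC mulrA; congr (_ * _).
by apply: eq_bigr => k /negbTE kj; rewrite ffunE kj.
Qed.

Lemma weight_remove x j l i : j \in route N i -> onth (x j) l = Some i ->
  weight (remove_packet x j l) * g i (wcount (remove_packet x j l) i) =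
  weight x * cap N j.
Proof.
move=> ji xl; rewrite -[in RHS](remove_packetK xl) weight_insert//.
by rewrite -!mulrA mulVf ?mulr1// gt_eqF// cap_gt0.
Qed.

Lemma weight_transfer x j j' l l' i : j \in route N i -> j' \in route N i ->
  onth (x j') l' = Some i ->
  weight (insert_packet (remove_packet x j' l') j l i) * cap N j =
  weight x * cap N j'.
Proof.
move=> ji j'i xl; rewrite weight_insert// mulrA weight_remove//.
by rewrite -!mulrA mulVf ?mulr1// gt_eqF// cap_gt0.
Qed.

Lemma has_esum_state x (F : words J I -> R) : valid N x -> 0 <= F x ->
  has_esum (fun s => if sval s == x then F (sval s) else 0) (F x).
Proof.
move=> vx Fx; apply: (@has_esum_point _ (state N) (exist _ x vx)) => //.
  move=> s; rewrite -val_eqE /= => /negbTE.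
  by rewrite /= => ->.
by rewrite /= eqxx.
Qed.

Lemma route_of_onth s j l i : onth (word s j) l = Some i -> j \in route N i.
Proof.
move=> sl; have /forallP/(_ j)/allP := valid_state s; apply.
by apply/onthP; exists l.
Qed.

Let g_ge0 i k : 0 <= g i k. Proof. exact: expR_ge0. Qed.
Let gam_ge0 j n (l : 'I_n) : 0 <= cap N j * gamma N j l n.
Proof. by rewrite mulr_ge0 ?gamma_ge0// ltW// cap_gt0. Qed.
Let del_ge0 j n (l : 'I_n) : 0 <= delta N j l n.
Proof. exact: delta_ge0. Qed.

Lemma injection_out s : has_esum (fun s' => injection_rate g s s')
  (\sum_i \sum_(j | is_first N i j) \sum_(l < (size (word s j)).+1)
     g i (wcount (sval s) i) * delta N j l (size (word s j)).+1).
Proof.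
apply: has_esum_sum => i _; apply: has_esum_sum => j /andP[ji _].
apply: has_esum_sum => l _.
apply: (@has_esum_state (insert_packet (sval s) j l i)
  (fun=> g i (wcount (sval s) i) * delta N j l (size (word s j)).+1)).
  exact/valid_insert/valid_state.
by rewrite mulr_ge0.
Qed.

Lemma transfer_out s : has_esum (fun s' => transfer_rate s s')
  (\sum_i \sum_j \sum_(j' | is_next N i j j')
   \sum_(l < size (word s j) | onth (word s j) l == Some i)
   \sum_(l' < (size (word s j')).+1)
     cap N j * gamma N j l (size (word s j))
         * delta N j' l' (size (word s j')).+1).
Proof.
apply: has_esum_sum => i _; apply: has_esum_sum => j _.
apply: has_esum_sum => j' /and3P[_ ji' _].
apply: has_esum_sum => l /eqP sl; apply: has_esum_sum => l' _.
apply: (@has_esum_state (insert_packet (remove_packet (sval s) j l) j' l' i)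
  (fun=> cap N j * gamma N j l (size (word s j))
         * delta N j' l' (size (word s j')).+1)).
  exact/valid_insert/valid_remove/valid_state.
by rewrite mulr_ge0.
Qed.

Lemma ack_out s : has_esum (fun s' => ack_rate s s')
  (\sum_i \sum_(j | is_last N i j)
  \sum_(l < size (word s j) | onth (word s j) l == Some i)
    cap N j * gamma N j l (size (word s j))).
Proof.
apply: has_esum_sum => i _; apply: has_esum_sum => j /andP[ji _].
apply: has_esum_sum => l _.
apply: (@has_esum_state (remove_packet (sval s) j l)
  (fun=> cap N j * gamma N j l (size (word s j)))) => //.
exact/valid_remove/valid_state.
Qed.

(** A predecessor by injection is [s] without some packet that stands in the first queue of its
    route, and [weight_remove] turns its injection rate into the capacity. The factor [delta]
    survives: backwards in time it acts as a service proportion. *)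
Lemma injection_in s :
  has_esum (fun s' => weight (sval s') * injection_rate g s' s)
  (\sum_i \sum_(j | is_first N i j)
   \sum_(l < size (word s j) | onth (word s j) l == Some i)
     weight (sval s) * cap N j * delta N j l (size (word s j))).
Proof.
apply: (@eq_has_esum _ _ _ (fun s' => \sum_i \sum_(j | is_first N i j)
   \sum_(l < size (word s j) | onth (word s j) l == Some i)
   if sval s' == remove_packet (sval s) j l then
    weight (sval s') * g i (wcount (sval s') i)
      * delta N j l (size (word s j)) else 0) _ _ _ erefl).
  move=> s'; rewrite mulr_sumr; apply: eq_bigr => i _; rewrite mulr_sumr.
  apply: eq_bigr => j _; rewrite -big_mkcond -big_mkcondr mulr_sumr.
  apply: (@sum_ord_reindex _ _ _ (fun l => sval s == insert_packet (sval s') j l i)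
    (fun l => (onth (word s j) l == Some i) &&
              (sval s' == remove_packet (sval s) j l))
    (fun l => weight (sval s') * (g i (window_count s' i) *
       delta N j l (size (word s' j)).+1))
    (fun l => weight (sval s') * g i (wcount (sval s') i)
      * delta N j l (size (word s j)))) => l.
    exact: insert_packet_eq.
  move=> ls /andP[_ /eqP E]; rewrite mulrA; congr (_ * delta _ _ _ _).
  by rewrite /word E ffunE eqxx size_remove_at.
apply: has_esum_sum => i _; apply: has_esum_sum => j /andP[ji _].
apply: has_esum_sum => l /eqP sl.
rewrite -(weight_remove ji sl).
apply: (@has_esum_state (remove_packet (sval s) j l)
  (fun x => weight x * g i (wcount x i) * delta N j l (size (word s j)))).
  exact/valid_remove/valid_state.
by apply: mulr_ge0; [apply: mulr_ge0; [exact/ltW/weight_gt0|exact: g_ge0]|exact: del_ge0].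
Qed.

(** A predecessor by acknowledgement has one more packet, in the last queue of its route. The
    capacity in its weight cancels the service capacity and leaves the injection rate at [s], with
    [gamma] as insertion probability. *)
Lemma ack_in s :
  has_esum (fun s' => weight (sval s') * ack_rate s' s)
  (\sum_i \sum_(j | is_last N i j) \sum_(l < (size (word s j)).+1)
     weight (sval s) * g i (wcount (sval s) i)
       * gamma N j l (size (word s j)).+1).
Proof.
apply: (@eq_has_esum _ _ _ (fun s' => \sum_i \sum_(j | is_last N i j)
   \sum_(l < (size (word s j)).+1)
   if sval s' == insert_packet (sval s) j l i then
    weight (sval s') * (cap N j * gamma N j l (size (word s j)).+1)
    else 0) _ _ _ erefl).
  move=> s'; rewrite mulr_sumr; apply: eq_bigr => i _; rewrite mulr_sumr.
  apply: eq_bigr => j _; rewrite -big_mkcond -big_mkcondr mulr_sumr.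
  apply: (@sum_ord_reindex _ _ _
    (fun l => (onth (word s' j) l == Some i) &&
              (sval s == remove_packet (sval s') j l))
    (fun l => sval s' == insert_packet (sval s) j l i)
    (fun l => weight (sval s') * (cap N j * gamma N j l (size (word s' j))))
    (fun l => weight (sval s') * (cap N j * gamma N j l (size (word s j)).+1)))
    => l.
    by rewrite -insert_packet_eq.
  move=> ls /eqP E; congr (_ * (_ * gamma _ _ _ _)).
  by rewrite /word E ffunE eqxx size_insert_at.
apply: has_esum_sum => i _; apply: has_esum_sum => j /andP[ji _].
apply: has_esum_sum => l _.
rewrite (_ : weight (sval s) * _ * _ = weight (insert_packet (sval s) j l i) *
     (cap N j * gamma N j l (size (word s j)).+1)); last first.
  have c0 : cap N j != 0 by rewrite gt_eqF// cap_gt0.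
  by rewrite weight_insert//; field.
apply: (@has_esum_state (insert_packet (sval s) j l i)
  (fun x => weight x * (cap N j * gamma N j l (size (word s j)).+1))).
  exact/valid_insert/valid_state.
by apply: mulr_ge0; [exact/ltW/weight_gt0|exact: gam_ge0].
Qed.

Lemma transfer_in s :
  has_esum (fun s' => weight (sval s') * transfer_rate s' s)
  (\sum_i \sum_j \sum_(j' | is_next N i j j')
   \sum_(l' < size (word s j') | onth (word s j') l' == Some i)
   \sum_(l < (size (word s j)).+1)
     weight (sval s) * cap N j' * delta N j' l' (size (word s j'))
       * gamma N j l (size (word s j)).+1).
Proof.
apply: (@eq_has_esum _ _ _ (fun s' => \sum_i \sum_j \sum_(j' | is_next N i j j')
   \sum_(l' < size (word s j') | onth (word s j') l' == Some i)
   \sum_(l < (size (word s j)).+1)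
   if sval s' == insert_packet (remove_packet (sval s) j' l') j l i then
     weight (sval s') * (cap N j * gamma N j l (size (word s j)).+1 *
       delta N j' l' (size (word s j')))
    else 0) _ _ _ erefl).
  move=> s'; rewrite mulr_sumr; apply: eq_bigr => i _; rewrite mulr_sumr.
  apply: eq_bigr => j _; rewrite mulr_sumr; apply: eq_bigr => j' nxt.
  have jj' := is_next_neq nxt.
  rewrite mulr_sumr.
  under eq_bigr => l _ do rewrite -big_mkcond mulr_sumr.
  under [RHS]eq_bigr => l _ do rewrite -big_mkcond.
  apply: (@sum_ord_exchange _ _ _ _ _
    (fun l => onth (word s' j) l == Some i)
    (fun l' => onth (word s j') l' == Some i)
    (fun l l' => sval s == insert_packet (remove_packet (sval s') j l) j' l' i)
    (fun l' l => sval s' == insert_packet (remove_packet (sval s) j' l') j l i)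
    (fun l l' => weight (sval s') * (cap N j * gamma N j l (size (word s' j))
         * delta N j' l' (size (word s' j')).+1))
    (fun l' l => weight (sval s') * (cap N j * gamma N j l (size (word s j)).+1 *
       delta N j' l' (size (word s j'))))).
    by move=> l l'; rewrite transfer_eq.
  move=> l l' /and4P[ls _ _ /eqP E]; rewrite /word.
  have -> : sval s j = remove_at l (sval s' j).
    by rewrite E ffunE (negbTE jj') ffunE eqxx.
  have -> : sval s j' = insert_at l' i (sval s' j').
    by rewrite E ffunE eqxx ffunE [j' == j]eq_sym (negbTE jj').
  by rewrite size_insert_at size_remove_at.
apply: has_esum_sum => i _; apply: has_esum_sum => j _.
apply: has_esum_sum => j' /and3P[ji j'i _].
apply: has_esum_sum => l' /eqP sl; apply: has_esum_sum => l _.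
rewrite (_ : _ * _ * _ * _ =
     weight (insert_packet (remove_packet (sval s) j' l') j l i) *
     (cap N j * gamma N j l (size (word s j)).+1 *
       delta N j' l' (size (word s j')))); last first.
  by rewrite -(weight_transfer l ji j'i sl); ring.
apply: (@has_esum_state (insert_packet (remove_packet (sval s) j' l') j l i)
  (fun x => weight x * (cap N j * gamma N j l (size (word s j)).+1 *
       delta N j' l' (size (word s j'))))).
  exact/valid_insert/valid_remove/valid_state.
by apply: mulr_ge0; [exact/ltW/weight_gt0|apply: mulr_ge0; [exact: gam_ge0|exact: del_ge0]].
Qed.

End ProductForm.

(** * Balance equations *)

Section Balance.
Context (R : realType) (J I : finType) (N : network R J I).
Context (G : I -> nat -> R).
Implicit Types (j : J) (l : nat) (i : I) (s : state N).

Let g i k := expR (G i k.+1 - G i k).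

Lemma sum_is_first i (c : R) : \sum_(j | is_first N i j) c = c.
Proof.
have := route_neq0 N i; rewrite /is_first; case: (route N i) => [//|j0 r] _.
rewrite (eq_bigl (pred1 j0)) ?big_pred1_eq// => j /=.
by rewrite inE [j0 == j]eq_sym; case: eqP => //=; rewrite andbF.
Qed.

Lemma sum_is_last i (c : R) : \sum_(j | is_last N i j) c = c.
Proof.
have := route_neq0 N i; have := route_uniq N i; rewrite /is_last.
case: (route N i) => [//|j0 r] ur _.
rewrite (eq_bigl (pred1 (last j0 r))) ?big_pred1_eq// => j.
apply/andP/eqP => [[jr /eqP [e]]|->]; last by rewrite mem_last index_last.
have /= {1}<- := nth_index j0 jr.
by rewrite (last_nth j0) e.
Qed.

(** A served packet has exactly one continuation: one next queue, or departure. *)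
Lemma sum_is_next i j (c : R) : j \in route N i ->
  \sum_(j' | is_next N i j j') c + (if is_last N i j then c else 0) = c.
Proof.
move=> jr; rewrite /is_last jr /=; have ur := route_uniq N i.
case: eqP => [e|ne].
  rewrite big1 ?add0r// => j' /and3P[_ j'r /eqP e'].
  by move: j'r; rewrite -index_mem e' e ltnn.
have lt : ((index j (route N i)).+1 < size (route N i))%N.
  by rewrite ltn_neqAle; apply/andP; split; [apply/eqP|rewrite index_mem].
rewrite addr0 (eq_bigl (pred1 (nth j (route N i) (index j (route N i)).+1))).
  by rewrite big_pred1_eq.
move=> j'; apply/and3P/eqP => [[_ j'r /eqP <-]|->]; first by rewrite nth_index.
by rewrite jr mem_nth// index_uniq.
Qed.

Lemma sum_is_prev i j' (c : R) : j' \in route N i ->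
  \sum_(j | is_next N i j j') c + (if is_first N i j' then c else 0) = c.
Proof.
move=> jr; rewrite /is_first jr /=; have ur := route_uniq N i.
case: eqP => [e|/eqP ne].
  by rewrite big1 ?add0r// => j /and3P[_ j'r /eqP e']; move: e; rewrite e'.
have lt : ((index j' (route N i)).-1 < size (route N i))%N.
  by rewrite (leq_ltn_trans (leq_pred _))// index_mem.
rewrite addr0 (eq_bigl (pred1 (nth j' (route N i) (index j' (route N i)).-1))).
  by rewrite big_pred1_eq.
move=> j; apply/and3P/eqP => [[j'r _ /eqP ->]|->]; first by rewrite nth_index.
by rewrite jr mem_nth// index_uniq// prednK ?lt0n.
Qed.

Lemma sum_by_route s (A : J -> nat -> R) :
  \sum_i \sum_j \sum_(l < size (word s j) | onth (word s j) l == Some i) A j l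
  = \sum_j \sum_(l < size (word s j)) A j l.
Proof.
rewrite exchange_big; apply: eq_bigr => j _.
under eq_bigr => i _ do rewrite big_mkcond.
rewrite exchange_big; apply: eq_bigr => l _.
have : onth (word s j) l by rewrite onthTE.
case: (onth _ _) => [i0 _|//]; rewrite -big_mkcond (eq_bigl (pred1 i0)) ?big_pred1_eq//.
Qed.

Lemma sum_route_support s i j (A : nat -> R) : j \notin route N i ->
  \sum_(l < size (word s j) | onth (word s j) l == Some i) A l = 0.
Proof. by move=> jr; rewrite big1// => l /eqP /route_of_onth; rewrite (negbTE jr). Qed.

Definition exit_rate s : R :=
  \sum_i g i (wcount N (sval s) i)
  + \sum_j (if (0 < size (word s j))%N then cap N j else 0).

Lemma sum_gamma j n (c : R) :
  \sum_(l < n) c * gamma N j l n = if (0 < n)%N then c else 0.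
Proof.
case: n => [|n]; first by rewrite big_ord0.
by rewrite -mulr_sumr gamma_sum1 ?mulr1.
Qed.

Lemma sum_delta j n (c : R) :
  \sum_(l < n) c * delta N j l n = if (0 < n)%N then c else 0.
Proof.
case: n => [|n]; first by rewrite big_ord0.
by rewrite -mulr_sumr delta_sum1 ?mulr1.
Qed.

Lemma exit_rateE s : has_esum (queueing_rate N g s) (exit_rate s).
Proof.
have := has_esumD (has_esumD (injection_out G s) (transfer_out s)) (ack_out s).
apply: eq_has_esum => // ; rewrite /exit_rate -addrA; congr (_ + _).
  apply: eq_bigr => i _; rewrite -[LHS](sum_is_first i).
  by apply: eq_bigr => j _; rewrite sum_delta.
rewrite -(eq_bigr _ (fun j _ => sum_gamma j (size (word s j)) (cap N j))).
rewrite -(sum_by_route s (fun j l => cap N j * gamma N j l (size (word s j)))).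
rewrite -big_split; apply: eq_bigr => i _ /=.
rewrite (big_mkcond (is_last N i)) -big_split; apply: eq_bigr => j _ /=.
under [X in _ = X + _]eq_bigr => j' _ do
  under eq_bigr => l _ do rewrite sum_delta /=.
have [jr|jr] := boolP (j \in route N i); first by rewrite sum_is_next.
rewrite (@sum_route_support s i j (fun l => cap N j * gamma N j l (size (word s j))))//.
rewrite big1 => [|j' /and3P[]]; last by rewrite (negbTE jr).
by rewrite /is_last (negbTE jr) addr0.
Qed.

(** Partial balance: inflow by acknowledgements matches outflow by injections, and inflow by
    injections and transfers matches outflow by services. The reversed chain runs the routes
    backwards with [gamma] and [delta] exchanged, so the sums over positions are again 1. *)
Lemma weight_balance s :
  has_esum (fun s' => weight N G (sval s') * queueing_rate N g s' s)
           (weight N G (sval s) * exit_rate s).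
Proof.
have := has_esumD (has_esumD (injection_in G s) (transfer_in G s)) (ack_in G s).
apply: eq_has_esum => [s'|]; first by rewrite /queueing_rate !mulrDr.
rewrite /exit_rate mulrDr addrC; congr (_ + _); last first.
  rewrite mulr_sumr; apply: eq_bigr => i _; rewrite -[LHS](sum_is_last i).
  by apply: eq_bigr => j _; rewrite sum_gamma.
rewrite addrC mulr_sumr.
rewrite (eq_bigr (fun j => \sum_(l < size (word s j)) weight N G (sval s) * cap N j
   * delta N j l (size (word s j)))); last first.
  by move=> j _; rewrite sum_delta; case: ifP; rewrite ?mulr0.
rewrite -(sum_by_route s (fun j l => weight N G (sval s) * cap N j
  * delta N j l (size (word s j)))).
rewrite -big_split; apply: eq_bigr => i _ /=.
rewrite (exchange_big_dep xpredT)//=.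
rewrite (big_mkcond (is_first N i)) -big_split; apply: eq_bigr => j _ /=.
under [X in _ = X + _]eq_bigr => j' _ do
  under eq_bigr => l _ do rewrite sum_gamma /=.
have [jr|jr] := boolP (j \in route N i); first by rewrite sum_is_prev.
rewrite (@sum_route_support s i j (fun l => weight N G (sval s) * cap N j
  * delta N j l (size (word s j))))//.
rewrite big1 => [|j' /and3P[_]]; last by rewrite (negbTE jr).
by rewrite /is_first (negbTE jr) addr0.
Qed.

Lemma queueing_rate_ge0 s s' : 0 <= queueing_rate N g s s'.
Proof. by have [] := exit_rateE s. Qed.

(* [exit_rateE] and [weight_balance] sum over all states; the diagonal terms
   agree on both sides and cancel, so [q s s = 0] is not needed. *)
Lemma has_esum_off (T : choiceType) (f h : T -> R) (v : R) (t0 : T) :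
  has_esum f v -> has_esum h v -> f t0 = h t0 ->
  (\esum_(t in [set t | t != t0]) (f t)%:E =
   \esum_(t in [set t | t != t0]) (h t)%:E)%E.
Proof.
move=> [f0 fv] [h0 hv] fh; have := hv; rewrite -fv.
rewrite !(esumID [set t0] setT) => [|t _|t _]; rewrite ?lee_fin//.
have -> : [set t | t != t0] = ~` [set t0] by apply/seteqP; split=> t /= /eqP.
by rewrite !setTI !esum_set1 ?lee_fin// fh => /fin_addeI ->.
Qed.

Lemma weight_stationary s :
  (\esum_(s' in [set s' | s' != s]) (weight N G (sval s) * queueing_rate N g s s')%:E
  = \esum_(s' in [set s' | s' != s]) (weight N G (sval s') * queueing_rate N g s' s)%:E)%E.
Proof.
apply: (@has_esum_off _ _ _ (weight N G (sval s) * exit_rate s)) => //.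
- by apply: has_esumZl; [exact/ltW/weight_gt0|exact: exit_rateE].
- exact: weight_balance.
Qed.

End Balance.

(** * Reachability of the empty state *)

Lemma psumr_gt0 (R : numDomainType) (K : finType) (P : pred K) (F : K -> R) k0 :
  P k0 -> (forall k, P k -> 0 <= F k) -> 0 < F k0 -> 0 < \sum_(k | P k) F k.
Proof.
move=> Pk0 F0 Fk; rewrite (bigD1 k0)//= ltr_pwDl// sumr_ge0// => k /andP[Pk _].
exact: F0.
Qed.

Section Reachability.
Context (R : realType) (J I : finType) (N : network R J I).
Context (G : I -> nat -> R).
Implicit Types (x : words J I) (j : J) (l : nat) (i : I) (s : state N).

Let g i k := expR (G i k.+1 - G i k).

Let gam_ge0 j n (l : 'I_n) : 0 <= cap N j * gamma N j l n.
Proof. by rewrite mulr_ge0 ?gamma_ge0// ltW// cap_gt0. Qed.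
Let gamdel_ge0 j n (l : 'I_n) j' n' (l' : 'I_n') :
  0 <= cap N j * gamma N j l n * delta N j' l' n'.
Proof. by rewrite mulr_ge0 ?gam_ge0 ?delta_ge0. Qed.

Lemma transfer_rate_gt0 s s' i j j' (l : 'I_(size (word s j)))
    (l' : 'I_(size (word s j')).+1) :
  is_next N i j j' -> onth (word s j) l = Some i ->
  0 < gamma N j l (size (word s j)) -> 0 < delta N j' l' (size (word s j')).+1 ->
  sval s' = insert_packet (remove_packet (sval s) j l) j' l' i ->
  0 < transfer_rate s s'.
Proof.
move=> nxt sl g0 d0 E; rewrite /transfer_rate.
have F0 i1 j1 j1' (l1 : 'I_(size (word s j1))) (l1' : 'I_(size (word s j1')).+1) :
  0 <= (if sval s' == insert_packet (remove_packet (sval s) j1 l1) j1' l1' i1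
    then cap N j1 * gamma N j1 l1 (size (word s j1))
         * delta N j1' l1' (size (word s j1')).+1
    else 0) by case: ifP.
apply: (@psumr_gt0 _ _ _ _ i) => // [i1 _|]; first by do 4!apply: sumr_ge0 => ? _.
apply: (@psumr_gt0 _ _ _ _ j) => // [j1 _|]; first by do 3!apply: sumr_ge0 => ? _.
apply: (@psumr_gt0 _ _ _ _ j') => // [j1 _|]; first by do 2!apply: sumr_ge0 => ? _.
apply: (@psumr_gt0 _ _ _ _ l) => // [|l1 _|]; [exact/eqP|by apply: sumr_ge0 => ? _|].
apply: (@psumr_gt0 _ _ _ _ l') => //.
by rewrite E eqxx !mulr_gt0// cap_gt0.
Qed.

Lemma ack_rate_gt0 s s' i j (l : 'I_(size (word s j))) :
  is_last N i j -> onth (word s j) l = Some i ->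
  0 < gamma N j l (size (word s j)) ->
  sval s' = remove_packet (sval s) j l ->
  0 < ack_rate s s'.
Proof.
move=> lst sl g0 E; rewrite /ack_rate.
have F0 j1 (l1 : 'I_(size (word s j1))) :
  0 <= (if sval s' == remove_packet (sval s) j1 l1
    then cap N j1 * gamma N j1 l1 (size (word s j1)) else 0) by case: ifP.
apply: (@psumr_gt0 _ _ _ _ i) => // [i1 _|]; first by do 2!apply: sumr_ge0 => ? _.
apply: (@psumr_gt0 _ _ _ _ j) => // [j1 _|]; first by apply: sumr_ge0 => ? _.
apply: (@psumr_gt0 _ _ _ _ l) => //; first exact/eqP.
by rewrite E eqxx mulr_gt0// cap_gt0.
Qed.

Lemma injection_rate_ge0 s s' : 0 <= injection_rate g s s'.
Proof. by have [] := injection_out G s. Qed.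

Lemma transfer_rate_ge0 s s' : 0 <= transfer_rate s s'.
Proof. by have [] := transfer_out s. Qed.

Lemma ack_rate_ge0 s s' : 0 <= ack_rate s s'.
Proof. by have [] := ack_out s. Qed.

(** The number of services needed to empty the system without injections, the one at the current
    queue included; each service lowers it by 1. *)
Definition remaining_hops x : nat :=
  (\sum_j \sum_(i <- x j) (size (route N i) - index j (route N i)))%N.

Lemma remaining_hops_insert x j l i :
  remaining_hops (insert_packet x j l i) =
  (size (route N i) - index j (route N i) + remaining_hops x)%N.
Proof.
rewrite /remaining_hops (bigD1 j)//= [in RHS](bigD1 j)//= ffunE eqxx.
rewrite (perm_big _ (perm_insert_at l i (x j))) big_cons -!addnA.
congr (_ + (_ + _))%N.
by apply: eq_bigr => k /negbTE kj; rewrite ffunE kj.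
Qed.

Lemma remaining_hops_remove x j l i : onth (x j) l = Some i ->
  remaining_hops x =
  (size (route N i) - index j (route N i) + remaining_hops (remove_packet x j l))%N.
Proof. by move=> xl; rewrite -[in LHS](remove_packetK xl) remaining_hops_insert. Qed.

Definition empty_state : state N.
Proof.
by exists [ffun=> [::]]; apply/forallP => j; rewrite ffunE.
Defined.

Lemma exists_gt0 n (f : nat -> R) : (forall l, (l < n)%N -> 0 <= f l) ->
  \sum_(l < n) f l = 1 -> exists l : 'I_n, 0 < f l.
Proof.
move=> f0 f1; apply/not_existsP => f_le0; have := f1.
rewrite big1 => [/esym /eqP|l _]; first by rewrite oner_eq0.
by apply/eqP; rewrite eq_le f0// andbT leNgt; apply/negP/f_le0.
Qed.

Definition state_of x (vx : valid N x) : state N :=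
  exist (fun x => valid N x : Prop) x vx.

(** The service proportions of a non-empty queue sum to 1, so some position, not necessarily the
    head, is served at positive rate; likewise some position of the next queue is open to
    insertion. *)
Lemma service_step s : s != empty_state ->
  exists s', [/\ s' != s, 0 < queueing_rate N g s s' &
    (remaining_hops (sval s') < remaining_hops (sval s))%N].
Proof.
move=> sne.
have [j wj] : exists j, (0 < size (word s j))%N.
  apply: contrapT => /forallNP h; move/eqP: sne; apply; apply/val_inj/ffunP => j.
  rewrite ffunE; apply/eqP; rewrite -size_eq0 -leqn0 leqNgt; exact/negP/h.
suff [s' sr sh] : exists2 s', 0 < queueing_rate N g s s' &
    (remaining_hops (sval s') < remaining_hops (sval s))%N.
  by exists s'; split => //; apply: contraTneq sh => ->; rewrite ltnn.
have [l gl] := exists_gt0 (fun l => @gamma_ge0 _ _ _ N j (size (word s j)) l)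
  (gamma_sum1 N j wj).
have : onth (word s j) l by rewrite onthTE.
case sl : (onth (word s j) l) => [i|//] _.
have ji := route_of_onth sl.
have hj : (index j (route N i) < size (route N i))%N by rewrite index_mem.
have [lst|nlst] := boolP (is_last N i j).
  exists (state_of (valid_remove j l (valid_state s))).
    rewrite /queueing_rate ltr_wpDl ?addr_ge0 ?injection_rate_ge0 ?transfer_rate_ge0//.
    exact: (@ack_rate_gt0 _ _ i j l).
  by rewrite (remaining_hops_remove sl) /= -{1}[remaining_hops _]add0n ltn_add2r subn_gt0.
have : \sum_(j' | is_next N i j j') (1 : R) != 0.
  by have := sum_is_next 1 ji; rewrite (negbTE nlst) addr0 => ->; rewrite oner_neq0.
have [j' nxt|no] := pickP (is_next N i j); last by rewrite big_pred0 ?eqxx.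
move=> _; have /and3P[_ j'i /eqP hj'] := nxt.
have [l' dl'] := exists_gt0
  (fun l => @delta_ge0 _ _ _ N j' (size (word s j')).+1 l)
  (delta_sum1 N j' (ltn0Sn (size (word s j')))).
exists (state_of (valid_insert l' j'i (valid_remove j l (valid_state s)))).
  rewrite /queueing_rate ltr_pwDl ?ack_rate_ge0// ltr_wpDl ?injection_rate_ge0//.
  exact: (@transfer_rate_gt0 _ _ i j j' l l').
rewrite (remaining_hops_remove sl) /= remaining_hops_insert ltn_add2r hj'.
by rewrite subnS prednK ?subn_gt0.
Qed.

Lemma empty_state_reachable (P : state N -> Prop) :
  (forall s s', s' != s -> 0 < queueing_rate N g s s' -> P s -> P s') ->
  forall s, P s -> P empty_state.
Proof.
move=> Pstep s; have [n] := ubnP (remaining_hops (sval s)).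
elim: n s => // n IH s /ltnSE sn Ps.
have [<-//|/service_step[s' [s's qs hs]]] := eqVneq s empty_state.
by apply: (IH s'); [exact: leq_trans hs sn|exact: Pstep qs Ps].
Qed.

Lemma outflow_le (f : state N -> R) s : (forall s, 0 <= f s) ->
  (outflow (queueing_rate N g) f s <= (exit_rate G s * f s)%:E)%E.
Proof.
move=> f0; have [h0 e] := has_esumZl (f0 s) (exit_rateE G s).
by rewrite mulrC -e; apply: esum_subset.
Qed.

Lemma stationary_weight (B Z : R) (pi : state N -> R) :
  (forall i k, g i k <= B) ->
  (\esum_(s in [set: state N]) (weight N G (sval s))%:E = Z%:E)%E ->
  is_stationary (queueing_rate N g) pi ->
  forall s, pi s = Z^-1 * weight N G (sval s).
Proof.
move=> gB EZ Hpi.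
have w0 s : 0 <= weight N G (sval s) by exact/ltW/weight_gt0.
have Z0 : 0 < Z.
  rewrite -lte_fin -EZ; apply: lt_le_trans (_ : 0 < (weight N G (sval empty_state))%:E)%E _.
    by rewrite lte_fin weight_gt0.
  apply: (@esum_term_le _ _ setT (fun s => (weight N G (sval s))%:E)) => //.
  by rewrite lee_fin.
(* Uniqueness asks for a finite total flow; a bounded exit rate provides it for every probability
   distribution. *)
have M s : exit_rate G s <= \sum_(i : I) B + \sum_j cap N j.
  apply: lerD; apply: ler_sum; first by move=> i _; exact: gB.
    by move=> j _; case: ifP => // _; exact/ltW/cap_gt0.
have E0 s : 0 <= exit_rate G s.
  apply: addr_ge0; apply: sumr_ge0; first by move=> i _; exact: expR_ge0.
  by move=> j _; case: ifP => // _; exact/ltW/cap_gt0.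
have fin (f : state N -> R) : (forall s, 0 <= f s) ->
    (\esum_(s in [set: state N]) (f s)%:E = 1%E)%E ->
    (\esum_(s in [set: state N]) outflow (queueing_rate N g) f s < +oo)%E.
  move=> f0 f1; apply: (@le_lt_trans _ _
    (\esum_(s in [set: state N]) ((\sum_(i : I) B + \sum_j cap N j) * f s)%:E)%E).
    apply: le_esum => s _; apply: le_trans (outflow_le s f0) _.
    by rewrite lee_fin ler_wpM2r.
  by rewrite esumZl// ?f1 ?mule1 ?ltry//; exact: le_trans (E0 empty_state) (M _).
have Hmu : is_stationary (queueing_rate N g) (fun s => Z^-1 * weight N G (sval s)).
  split=> [s||s].
  - by rewrite mulr_ge0// invr_ge0 ltW.
  - by rewrite esumZl// ?EZ -?EFinM ?mulVf ?gt_eqF// invr_ge0 ltW.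
  - under eq_esum => s' _ do rewrite -mulrA.
    under [in RHS]eq_esum => s' _ do rewrite -mulrA.
    have Zi : 0 <= Z^-1 by rewrite invr_ge0 ltW.
    have hZ (f : state N -> R) := @esumZl _ _ [set s' | s' != s] _ f Zi.
    rewrite !hZ ?weight_stationary// => s'.
      by rewrite mulr_ge0 ?queueing_rate_ge0.
    by rewrite mulr_ge0 ?queueing_rate_ge0.
move=> s; have [pi0 pi1 _] := Hpi; have [mu0 mu1 _] := Hmu.
rewrite (stationary_unique (@queueing_rate_ge0 _ _ _ N G) Hpi Hmu
  (fin _ pi0 pi1) (fin _ mu0 mu1) empty_state_reachable)//.
Qed.

End Reachability.

(** * Generating functions of words *)

Section WordSums.
Context (R : realType) (I : finType).

Fixpoint words_of_size n : seq (seq I) :=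
  if n is n'.+1 then [seq i :: w | i <- enum I, w <- words_of_size n']
  else [:: [::]].

Lemma mem_words_of_size n w : (w \in words_of_size n) = (size w == n).
Proof.
elim: n w => [|n IH] [|i w] //=.
  by apply/negbTE/negP => /allpairsP[[? ?] []].
rewrite eqSS -IH; apply/allpairsP/idP => [[[i' w'] /= [_ w'n [_ ->]]]//|wn].
by exists (i, w); rewrite mem_enum.
Qed.

Lemma uniq_words_of_size n : uniq (words_of_size n).
Proof.
elim: n => // n IH /=; apply: allpairs_uniq => //; first exact: enum_uniq.
by move=> [i w] [i' w'] _ _ [-> ->].
Qed.

Lemma sum_words_of_size n (a : I -> R) :
  \sum_(w <- words_of_size n) \prod_(i <- w) a i = (\sum_i a i) ^+ n.
Proof.
elim: n => [|n IH]; first by rewrite big_seq1 big_nil.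
rewrite [LHS](big_allpairs_dep) exprS -IH mulr_suml big_enum /=.
apply: eq_bigr => i _; rewrite mulr_sumr; apply: eq_bigr => w _.
by rewrite big_cons.
Qed.

Lemma sum_bseq_size M n (Q : pred I) (a : I -> R) : (n <= M)%N ->
  \sum_(w : M.-bseq I | (size w == n) && all Q w) \prod_(i <- w) a i
  = (\sum_(i | Q i) a i) ^+ n.
Proof.
move=> nM; pose b i := if Q i then a i else 0.
have prodb (w : seq I) : \prod_(i <- w) b i = if all Q w then \prod_(i <- w) a i else 0.
  elim: w => [|i w IH]; first by rewrite !big_nil.
  rewrite !big_cons IH /= /b; case: (Q i) => //=; last by rewrite mul0r.
  by case: ifP => // _; rewrite mulr0.
rewrite big_mkcondr /=; under eq_bigr do rewrite -prodb.
rewrite [X in X ^+ n]big_mkcond -sum_words_of_size.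
rewrite -big_filter -(big_map val xpredT (fun w => \prod_(i <- w) b i)).
apply: perm_big; apply: uniq_perm.
- by rewrite map_inj_uniq; [rewrite filter_uniq// index_enum_uniq|exact: val_inj].
- exact: uniq_words_of_size.
- move=> w; rewrite mem_words_of_size; apply/mapP/eqP => [[w' + ->]|wn].
    by rewrite mem_filter => /andP[/eqP].
  have wM : (size w <= M)%N by rewrite wn.
  by exists (Bseq wM) => //; rewrite mem_filter mem_index_enum andbT; apply/eqP.
Qed.

Lemma sum_bseq M (Q : pred I) (a : I -> R) :
  \sum_(w : M.-bseq I | all Q w) \prod_(i <- w) a i
  = \sum_(n < M.+1) (\sum_(i | Q i) a i) ^+ n.
Proof.
rewrite (partition_big (fun w : M.-bseq I => inord (size w) : 'I_M.+1) xpredT) //=.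
apply: eq_bigr => n _; rewrite -(sum_bseq_size Q a (ltn_ord n : n <= M)%N).
apply: eq_bigl => w; rewrite andbC -val_eqE /= inordK// ltnS; exact: size_bseq.
Qed.

End WordSums.

Section StateSums.
Context (R : realType) (J I : finType) (N : network R J I).
Context (a : J -> I -> R).
Hypothesis a_ge0 : forall j i, 0 <= a j i.

Definition word_prod (x : words J I) : R := \prod_j \prod_(i <- x j) a j i.

Lemma word_prod_ge0 x : 0 <= word_prod x.
Proof. by apply: prodr_ge0 => j _; apply: prodr_ge0. Qed.

(** Capping the lengths at [M] leaves finitely many functions on the queues, so the sum of products
    factors into a product of sums, one per queue. *)
Lemma word_prod_sum M (P : J -> pred nat) :
  has_esum (fun s : state N =>
    if [forall j, (size (word s j) <= M)%N && P j (size (word s j))]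
    then word_prod (sval s) else 0)
  (\prod_j \sum_(w : M.-bseq I | P j (size w) && all (fun i => j \in route N i) w)
     \prod_(i <- w) a j i).
Proof.
pose F j (w : M.-bseq I) :=
  if P j (size w) && all (fun i => j \in route N i) w
  then \prod_(i <- w) a j i else 0.
have F0 j w : 0 <= F j w by rewrite /F; case: ifP => // _; apply: prodr_ge0.
pose X (f : {ffun J -> M.-bseq I}) : words J I := [ffun j => val (f j)].
apply: (@eq_has_esum _ _ _ (fun s => \sum_(f : {ffun J -> M.-bseq I})
  if sval s == X f then \prod_j F j (f j) else 0) _
  (\sum_(f : {ffun J -> M.-bseq I}) \prod_j F j (f j))).
- move=> s; case: ifP => [/forallP sM|/negbT /forallPn[j sj]].
    have sM' j : (size (sval s j) <= M)%N by have /andP[] := sM j.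
    pose f0 : {ffun J -> M.-bseq I} := [ffun j => Bseq (sM' j)].
    have Xf0 : sval s = X f0 by apply/ffunP => j; rewrite !ffunE.
    rewrite (bigD1 f0)//= Xf0 eqxx [X in _ + X]big1 ?addr0 => [|f ff0].
      rewrite /word_prod; apply: eq_bigr => j _; rewrite /F ifT ?ffunE//=.
      have /andP[_ ->] := sM j; exact: (forallP (valid_state s) j).
    case: eqP => // Xf; case/eqP: ff0; apply/ffunP => j; apply/val_inj.
    by move/ffunP/(_ j): Xf; rewrite !ffunE.
  rewrite big1// => f _; case: eqP => // sX.
  apply/eqP/prodf_eq0; exists j => //; rewrite /F ifF//.
  move: sj; rewrite /word sX ffunE size_bseq /= => /negbTE ->//.
- rewrite -bigA_distr_bigA; apply: eq_bigr => j _; exact: big_mkcond.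
apply: has_esum_sum => f _.
have [vf|nvf] := boolP (valid N (X f)).
  apply: (@has_esum_state _ _ _ _ (X f) (fun=> \prod_j F j (f j))) => //.
  by apply: prodr_ge0.
have -> : \prod_j F j (f j) = 0.
  move: nvf => /forallPn[j nj]; apply/eqP/prodf_eq0; exists j => //.
  by rewrite /F ifF//; move: nj; rewrite ffunE => /negbTE ->; rewrite andbF.
split=> [t|]; first by case: ifP.
by rewrite esum1// => t _; case: ifP.
Qed.

Lemma word_prod_size (n : J -> nat) :
  has_esum (fun s : state N =>
    if [forall j, size (word s j) == n j] then word_prod (sval s) else 0)
  (\prod_j (\sum_(i | j \in route N i) a j i) ^+ n j).
Proof.
pose M := (\max_j n j)%N.
have := word_prod_sum M (fun j k => k == n j); apply: eq_has_esum => [s|].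
  congr (if _ then _ else _); apply: eq_forallb => j.
  by case: eqP => [->|]; rewrite ?andbF// andbT /M leq_bigmax.
by apply: eq_bigr => j _; rewrite sum_bseq_size// /M leq_bigmax.
Qed.

(** A finite set of states has a common bound on its queue lengths, and under this bound each queue
    contributes a partial geometric series of ratio at most [r]. *)
Lemma word_prod_total (r : R) : 0 <= r < 1 ->
  (forall j, \sum_(i | j \in route N i) a j i <= r) ->
  (\esum_(s in [set: state N]) (word_prod (sval s))%:E
     <= ((1 - r)^-1 ^+ #|J|)%:E)%E.
Proof.
move=> /andP[r0 r1] ar; apply: ge_ereal_sup => _ [F [finF _] <-].
rewrite fsbig_finite//=.
pose M := (\max_(s <- finmap.enum_fset (fset_set F)) \max_j size (word s j))%N.
have sM s j : s \in F -> (size (word s j) <= M)%N.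
  move=> sF; apply: (@leq_trans (\max_j size (word s j))%N).
    exact: (leq_bigmax (F := fun j => size (word s j))).
  apply: (@leq_bigmax_seq _ _ xpredT (fun s => (\max_j size (word s j))%N) s) => //.
  by rewrite in_fset_set.
have [h0 hv] := word_prod_sum M (fun _ _ => true).
apply: (@le_trans _ _ (\prod_j \sum_(w : M.-bseq I | true && all (fun i => j \in route N i) w)
     \prod_(i <- w) a j i)%:E).
  rewrite -hv; apply: esum_ge; exists F => //; rewrite fsbig_finite//=.
  rewrite big_seq [in leRHS]big_seq; apply: lee_sum => s.
  rewrite in_fset_set// => sF; rewrite ifT//; apply/forallP => j.
  by rewrite sM.
rewrite lee_fin -prodr_const; apply: ler_prod => j _; apply/andP; split.
  by apply: sumr_ge0 => w _; apply: prodr_ge0.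
rewrite /= sum_bseq; apply: (@le_trans _ _ (\sum_(n < M.+1) r ^+ n)).
  by apply: ler_sum => n _; rewrite lerXn2r// nnegrE sumr_ge0.
have h : (1 - r) * \sum_(n < M.+1) r ^+ n = 1 - r ^+ M.+1.
  by rewrite -[X in X - r ^+ _](expr1n _ M.+1) subrXX; congr (_ * _);
     apply: eq_bigr => n _; rewrite expr1n mul1r.
rewrite -[leLHS](mulKf (_ : 1 - r != 0)); last by rewrite subr_eq0 gt_eqF.
rewrite h ler_piMr// ?invr_ge0 ?subr_ge0 ?(ltW r1)//.
by rewrite lerBlDr lerDl exprn_ge0.
Qed.

End StateSums.

(** * Utilities and congestion windows *)

Lemma derive1_approx (R : realType) (f : R -> R) (y : R) :
  derivable f y 1 -> forall e, 0 < e -> exists2 r, 0 < r &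
  forall h, `|h| < r -> `|f (y + h) - f y - f^`()%classic y * h| <= e * `|h|.
Proof.
move=> df e e0.
have : h^-1 *: ((f \o shift y) (h *: 1) - f y) @[h --> 0^'] --> f^`()%classic y.
  by rewrite derive1E; exact: df.
move/cvgrPdist_le => /(_ e e0) [r /= r0 H]; exists r => // h hr.
have [->|h0] := eqVneq h 0; first by rewrite addr0 subrr mulr0 subr0 normr0 mulr0.
have /= := H h; rewrite sub0r normrN => /(_ hr h0).
rewrite /GRing.scale /= mulr1 [h + y]addrC => H1.
have -> : f (y + h) - f y - f^`()%classic y * h =
    - (f^`()%classic y - h^-1 * (f (y + h) - f y)) * h.
  by field.
by rewrite normrM normrN ler_wpM2r.
Qed.

Lemma concave_tangent (R : realType) (D : set R) (f : R -> R) (y z : R) :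
  strictly_concave_on D f -> D y -> D z -> derivable f y 1 ->
  f z <= f y + f^`()%classic y * (z - y).
Proof.
move=> cf Dy Dz df.
have [->|zy] := eqVneq z y; first by rewrite subrr mulr0 addr0.
rewrite leNgt; apply/negP => lt.
set gap := f z - (f y + f^`()%classic y * (z - y)).
have gap0 : 0 < gap by rewrite subr_gt0.
have n0 : 0 < `|z - y| by rewrite normr_gt0 subr_eq0.
have e0 : 0 < gap / `|z - y| by rewrite divr_gt0.
have [r r0 H] := derive1_approx df e0.
(* This [t] keeps the moved point within [r] of [y]. Strict concavity then puts [f] above the
   tangent by more than [t * gap], which is exactly the error allowed by [H]. *)
pose t := Num.min (2^-1) (r / 2 / `|z - y|).
have t0 : 0 < t by rewrite lt_min invr_gt0 ltr0n /= !divr_gt0.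
have t1 : t <= 2^-1 by rewrite ge_min lexx.
have tr : t * `|z - y| <= r / 2.
  by rewrite -ler_pdivlMr// ge_min lexx orbT.
have := H (t * (z - y)); rewrite normrM (gtr0_norm t0).
have -> : t * `|z - y| < r by lra.
move=> /(_ isT); rewrite [X in _ <= X]mulrCA divfK ?gt_eqF// => /ler_normlP[_].
have t01 : 0 < t < 1 by apply/andP; split; [|lra].
have := cf z y t Dz Dy zy t01.
have -> : t * z + (1 - t) * y = y + t * (z - y) by ring.
have -> : f^`()%classic y * (t * (z - y)) = t * (f^`()%classic y * (z - y)) by ring.
rewrite /gap; set A := f^`()%classic y * (z - y).
by nra.
Qed.

Section Utility.
Context (R : realType) (U : R -> R).
Hypotheses (HU : is_utility U) (HA1 : assumption1 U) (HA2 : assumption2 U).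

Let G := window_fun U.

Lemma utility_tangent y z : 0 < y -> 0 < z ->
  U z <= U y + U^`()%classic y * (z - y).
Proof.
move=> y0 z0; apply: (concave_tangent (utility_concave HU)) => //.
exact: utility_derivable.
Qed.

Lemma utility_derive_gt0 y : 0 < y -> 0 < U^`()%classic y.
Proof.
move=> y0; have y2 : y < 2 * y by lra.
have := utility_incr HU y0 y2.
have := @utility_tangent y (2 * y) y0 ltac:(lra).
have -> : 2 * y - y = y by ring.
by move=> a b; rewrite -(pmulr_lgt0 _ y0); lra.
Qed.

Lemma utility_ext_gt0 x : 0 < x -> utility_ext U x = (U x)%:E.
Proof. by rewrite /utility_ext => ->. Qed.

Lemma utility_ext0_le_value z : 0 < z -> (utility_ext U 0 <= (U z)%:E)%E.
Proof.
move=> z0; rewrite /utility_ext ltxx.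
have nd : {in Interval (BRight (0 : R)) +oo%O &, nondecreasing_fun (fun y => (U y)%:E)}.
  move=> a c; rewrite !in_itv /= !andbT => a0 c0 ac; rewrite lee_fin.
  move: ac; rewrite le_eqVlt => /orP[/eqP->//|ac].
  exact/ltW/(utility_incr HU).
rewrite (cvg_lim _ (@nondecreasing_at_right_cvge _ _ (0 : R) +oo%O isT nd))//.
by apply: ereal_inf_lbound; exists z => //=; rewrite in_itv /= z0.
Qed.

(** The tangent at [y] continued down to 0 bounds the limit there. The bound keeps the slope at [y],
    which becomes arbitrarily large for small [y]. *)
Lemma utility_ext0_le y :
  0 < y -> (utility_ext U 0 <= (U y - y * U^`()%classic y)%:E)%E.
Proof.
move=> y0; apply/lee_addgt0Pr => e e0.
have u0 := utility_derive_gt0 y0.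
have z0 : 0 < e / U^`()%classic y by rewrite divr_gt0.
apply: le_trans (utility_ext0_le_value z0) _.
rewrite -EFinD lee_fin; apply: le_trans (utility_tangent y0 z0) _.
by rewrite mulrBr mulrCA divff ?gt_eqF// mulr1; lra.
Qed.

(** The Fenchel-Young inequality: [G] is the concave conjugate of [t |-> U (expR t)]. *)
Lemma window_fun_le y lam : window_fun_ext U y \is a fin_num ->
  G y <= y * lam - U (expR lam).
Proof.
move=> yf; rewrite -lee_fin /G /window_fun fineK// /window_fun_ext.
rewrite leeNl -EFinN opprB; apply: ereal_sup_ubound; exists lam => //.
Qed.

Context (L : R).
Hypothesis L0 : 0 < L.
Let lam := ln L.
Let x := L * U^`()%classic L.

Lemma target_window_gt0 : 0 < x.
Proof. by rewrite mulr_gt0// utility_derive_gt0. Qed.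

Let h t := U (expR t).

Let expR_lam : expR lam = L. Proof. by rewrite lnK. Qed.

Lemma derivable_utility_exp : derivable h lam 1.
Proof.
have dU : is_derive (expR lam) 1 U (U^`()%classic (expR lam)).
  by rewrite derive1E; apply: DeriveDef => //; apply: utility_derivable; rewrite ?expR_gt0.
by have := is_derive1_comp dU (is_derive_expR lam); case.
Qed.

Lemma derive1_utility_exp : h^`()%classic lam = x.
Proof.
have dU : is_derive (expR lam) 1 U (U^`()%classic (expR lam)).
  by rewrite derive1E; apply: DeriveDef => //; apply: utility_derivable; rewrite ?expR_gt0.
have := is_derive1_comp dU (is_derive_expR lam) => dh.
by rewrite derive1E (@derive_val _ _ _ _ _ _ _ dh) expR_lam mulrC.
Qed.

(** Equality in [window_fun_le]: the concave function [t |-> U (expR t)] has slope [x] at [lam], so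
    the supremum is attained at [lam]. *)
Lemma window_fun_target : G x = x * lam - U L.
Proof.
have xf : window_fun_ext U x \is a fin_num by exact/window_fin/target_window_gt0.
have := window_fun_le lam xf; rewrite expR_lam => le1.
apply/eqP; rewrite eq_le le1 /= -lee_fin /G /window_fun fineK//.
rewrite /window_fun_ext leeNr; apply: ge_ereal_sup => _ [t _ <-].
rewrite -EFinN lee_fin opprB.
have := @concave_tangent _ _ h lam t HA1 Logic.I Logic.I derivable_utility_exp.
by rewrite derive1_utility_exp /h expR_lam; nra.
Qed.

Lemma window_gap_le0 y : window_fun_ext U y \is a fin_num ->
  G y - y * lam + U L <= 0.
Proof. by move=> yf; have := window_fun_le lam yf; rewrite expR_lam; lra. Qed.

(** The function [y |-> G y - y * lam] has an interior maximum at [x]. *)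
Lemma derive1_window_target : (G^`()%classic) x = lam.
Proof.
have x0 := target_window_gt0.
pose f y := G y - y * lam.
have df y : 0 < y -> derivable f y 1.
  move=> y0; apply: derivableB; first exact: window_derivable.
  by apply: derivableM.
have dx : is_derive x 1 f 0.
  apply: (@derive1_at_max _ f 0 (2 * x)).
  - lra.
  - by move=> t; rewrite in_itv => /andP[t0 _]; exact: df.
  - by rewrite in_itv /= x0 /=; lra.
  - move=> t; rewrite in_itv => /andP[t0 _]; rewrite /f window_fun_target.
    by have := window_gap_le0 (window_fin HA2 t0); lra.
have -> : G = (f \+ (fun y => y * lam))%R by apply/funext => y; rewrite /f /= subrK.
rewrite derive1E.
have dl : is_derive x 1 (fun y => y * lam) lam.
  by apply: is_derive_eq; rewrite /GRing.scale /= mulr0 add0r mulr1.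
have dfx := is_deriveD dx dl.
by rewrite (@derive_val _ _ _ _ _ _ _ dfx) add0r.
Qed.

(** Testing [window_fun_le] at [lam + r / 2] for [y] below [x], and at [lam - r / 2] above, bounds
    the gap by lines that fall at rate [r / 2] away from [x], up to an error [eta * r / 4]. Beyond
    distance [eta] the error takes at most half of the decrease, which leaves [r / 4]. *)
Lemma window_gap_linear eta : 0 < eta -> exists2 kappa, 0 < kappa &
  forall y, window_fun_ext U y \is a fin_num -> eta <= `|y - x| ->
  G y - y * lam + U L <= - kappa * `|y - x|.
Proof.
move=> eta0; have e0 : 0 < eta / 2 by lra.
have [r r0 H] := derive1_approx derivable_utility_exp e0.
have rr : `|r / 2| < r by rewrite ger0_norm; lra.
have rr' : `|- (r / 2)| < r by rewrite normrN.
have := H _ rr; have := H _ rr'; rewrite derive1_utility_exp normrN.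
have -> : `|r / 2| = r / 2 by rewrite ger0_norm//; lra.
rewrite /h expR_lam => /ler_normlP[Hm _] /ler_normlP[Hp _].
exists (r / 4) => [|y yf]; first by lra.
have := window_fun_le (lam + r / 2) yf; have := window_fun_le (lam - r / 2) yf.
case: (lerP 0 (y - x)) => yx.
  rewrite (ger0_norm yx) => Gm Gp yeta; nra.
rewrite (ltr0_norm yx) => Gm Gp yeta; nra.
Qed.

Lemma window_gap_continuous eps : 0 < eps -> exists2 r, 0 < r &
  forall y, `|y - x| < r -> - eps <= G y - y * lam + U L.
Proof.
move=> eps0; have x0 := target_window_gt0.
have [r r0 H] := derive1_approx (window_derivable HA2 x0) (ltr01 : 0 < 1 :> R).
exists (Num.min r eps) => [|y]; first by rewrite lt_min r0.
rewrite lt_min => /andP[/H]; rewrite mul1r derive1_window_target.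
have -> : x + (y - x) = y by ring.
rewrite -/G window_fun_target => /ler_normlP[Hm _] yeps; lra.
Qed.

(** Concavity is available at positive arguments only, and the argument at [k = 0] may be 0; the
    rates are shown to decrease from [k = 1] on, and the first one is kept apart. *)
Lemma injection_fun_bounded (c : nat) (d : R) : (0 < c)%N ->
  scaled_window_defined U c d -> exists B, forall k, injection_fun U c d k <= B.
Proof.
move=> c0 Hd; exists (Num.max (injection_fun U c d 0) (injection_fun U c d 1)).
case=> [|k]; first by rewrite le_max lexx.
rewrite le_max; apply/orP; right; elim: k => [//|k]; apply: le_trans.
rewrite /injection_fun ler_expR /scaled_window_fun -!mulrBr.
have c0' : 0 < c%:R :> R by rewrite ltr0n.
rewrite ler_pM2l//.
have sE m : scaled_arg c d m.+1 = scaled_arg c d m + c%:R^-1.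
  by rewrite /scaled_arg -[m.+1]addn1 natrD mulrDl mul1r; ring.
have ci : 0 < (c%:R)^-1 :> R by rewrite invr_gt0.
have a0 : 0 < scaled_arg c d k.+1.
  by rewrite sE; have [+ _] := Hd k; lra.
have a2 : 0 < scaled_arg c d k.+3 by rewrite (sE k.+2) (sE k.+1); lra.
have ne : scaled_arg c d k.+1 != scaled_arg c d k.+3.
  by rewrite (sE k.+2) (sE k.+1) lt_eqF//; lra.
have half : 0 < (2^-1 : R) < 1 by apply/andP; split; lra.
have := @window_concave _ _ HA2 _ _ 2^-1 a0 a2 ne half.
have -> : 2^-1 * scaled_arg c d k.+1 + (1 - 2^-1) * scaled_arg c d k.+3 =
  scaled_arg c d k.+2 by rewrite (sE k.+2) (sE k.+1); lra.
by move=> H; lra.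
Qed.

End Utility.

(** * Lagrange multipliers *)

Lemma continuous_sumr (R : realType) (T : topologicalType) (K : finType)
    (P : pred K) (f : K -> T -> R) :
  (forall k, continuous (f k)) -> continuous (fun x => \sum_(k | P k) f k x).
Proof.
move=> fc; rewrite -fct_sumE; apply: (big_ind (fun g : T -> R => continuous g)).
- exact: cst_continuous.
- by move=> f1 f2 h1 h2 x; apply: continuousD; [exact: h1|exact: h2].
- by move=> k _; exact: fc.
Qed.

Section FiniteDim.
Context (R : realType) (T : finType).

(** Functions on a finite type are read off row vectors, where closed boxes are compact and the
    extreme value theorem applies. *)
Definition row_fun (v : 'rV[R]_#|T|) : T -> R := fun t => v ord0 (enum_rank t).

Lemma row_funK (m : T -> R) : row_fun (\row_k m (enum_val k)) = m.
Proof. by apply/funext => t; rewrite /row_fun mxE enum_rankK. Qed.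

Lemma row_fun_continuous t : continuous (fun v => row_fun v t).
Proof. exact: coord_continuous. Qed.

Lemma closed_box (B : R) : closed [set v | forall t, 0 <= row_fun v t <= B].
Proof.
rewrite (_ : mkset _ =
    \bigcap_(t in [set: T]) ((fun v => row_fun v t) @^-1` `[0, B]%classic)).
  apply: closed_bigI => t _; apply: preimage_closed; last exact: itv_closed.
  by move=> v _; exact: row_fun_continuous.
apply/seteqP; split=> v /=; first by move=> h t _ /=; rewrite in_itv; exact: h.
by move=> h t; have := h t Logic.I; rewrite /= in_itv.
Qed.

Lemma box_min (B : R) (E : set (T -> R)) (psi : (T -> R) -> R) :
  closed [set v | E (row_fun v)] ->
  continuous (fun v => psi (row_fun v)) ->
  (forall m, E m -> forall t, 0 <= m t <= B) -> E !=set0 ->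
  exists2 m, E m & forall m', E m' -> psi m <= psi m'.
Proof.
move=> Ec psic EB [m0 Em0].
have cE : compact [set v | E (row_fun v)].
  apply: (subclosed_compact Ec (@rV_compact _ _ (fun=> `[0, B]%classic) _)).
    by move=> i; exact: segment_compact.
  move=> v /= /EB vB i; have := vB (enum_val i).
  by rewrite /row_fun enum_valK in_itv.
have E0 : [set v | E (row_fun v)] !=set0.
  by exists (\row_k m0 (enum_val k)); rewrite /= row_funK.
have [v] := EVT_min_rV E0 cE (continuous_subspaceT psic).
rewrite inE /= => Ev vmin; exists (row_fun v) => // m' Em'.
have := vmin (\row_k m' (enum_val k)); rewrite inE /= row_funK; exact.
Qed.

End FiniteDim.

Lemma near_right_lt_affine (R : realType) (a v b : R) : a < b ->
  \forall t \near 0^'+, a + t * v < b.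
Proof.
move=> ab; have v1 : 0 < `|v| + 1 by rewrite ltr_pwDr.
have r0 : 0 < (b - a) / (`|v| + 1) by rewrite divr_gt0// subr_gt0.
near=> t.
have t0 : 0 < t by near: t; exact: nbhs_right_gt.
have tr : t < (b - a) / (`|v| + 1) by near: t; exact: nbhs_right_lt.
rewrite -ltrBrDl; move: tr; rewrite ltr_pdivlMr//; apply: le_lt_trans.
by apply: ler_wpM2l; [exact: ltW|rewrite (le_trans (ler_norm _))// lerDl].
Unshelve. all: by end_near. Qed.

Section KKT.
Context (R : realType) (J I : finType) (N : network R J I) (U : I -> R -> R).
Context (L : I -> R).
Hypothesis HU : forall i, is_utility (U i).
Hypothesis Lopt : system_optimal N U L.

Lemma optimal_ge0 i : 0 <= L i.
Proof. by have [[+ _] _] := Lopt. Qed.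

Lemma optimal_cap j : \sum_(i | j \in route N i) L i <= cap N j.
Proof. by have [[_ +] _] := Lopt. Qed.

Lemma system_objective_gt0 L' : (forall i, 0 < L' i) ->
  system_objective U L' = (\sum_i U i (L' i))%:E.
Proof.
move=> L'0; rewrite /system_objective -sumEFin; apply: eq_bigr => i _.
by rewrite utility_ext_gt0.
Qed.

(** If a rate were 0, a move of a fraction [e] towards a constant positive allocation would pay:
    concavity limits the total loss to [e * K], while the infinite slope at 0 makes route [i] gain
    more. *)
Lemma optimal_gt0 i : 0 < L i.
Proof.
rewrite lt_def optimal_ge0 andbT; apply/negP => /eqP Li0.
have [D [D0 Dcap]] : exists D, 0 < D /\
    forall j, \sum_(i | j \in route N i) D <= cap N j.
  have := @filter_forall R J (fun j t => 0 + t * #|I|%:R < cap N j) 0^'+ _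
    (fun j => near_right_lt_affine _ (cap_gt0 N j)) => H.
  near (0 : R)^'+ => t.
  have t0 : 0 < t by near: t; exact: nbhs_right_gt.
  exists t; split => // j; apply: le_trans (ltW (_ : 0 + t * #|I|%:R < cap N j)).
    rewrite add0r sumr_const -(mulr_natr t) ler_wpM2l ?ler_nat ?max_card//; exact: ltW.
  move: j; near: t; exact: H.
have fD : feasible N (fun=> D) by split => // k; exact: ltW.
have := Lopt.2 _ fD; rewrite system_objective_gt0// => objL.
(* The finite objective at [D] excludes [-oo] for every term, and the value at 1 bounds the limit at
   0 from above. *)
have extfin k : utility_ext (U k) (L k) \is a fin_num.
  rewrite fin_numE; apply/andP; split.
    apply/eqP => e; move: objL; rewrite /system_objective.
    have -> : (\sum_i utility_ext (U i) (L i) = -oo)%E.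
      by apply/esum_eqNyP; exists k; rewrite mem_index_enum.
    by rewrite leeNy_eq.
  have := optimal_ge0 k; rewrite le_eqVlt => /orP[/eqP <-|h]; last by rewrite utility_ext_gt0.
  by rewrite -ltey; apply: le_lt_trans (utility_ext0_le_value (HU k) ltr01) (ltry _).
pose a k := fine (utility_ext (U k) (L k)).
have objE : system_objective U L = (\sum_k a k)%:E.
  by rewrite /system_objective -sumEFin; apply: eq_bigr => k _; rewrite fineK.
pose K := \sum_k `|U k D - a k|.
(* With this slope the new rate [z = e * D] of route [i] brings a gain of [e * K + z], beating the
   loss by [z]. *)
have [z [z0 zD Uz]] : exists z, [/\ 0 < z, z < D & K / D + 1 <= (U i)^`()%classic z].
  have := utility_derive0 (HU i); move/cvgryPge => /(_ (K / D + 1)) H.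
  near (0 : R)^'+ => z; exists z; split; near: z => //.
  - exact: nbhs_right_gt.
  - exact: nbhs_right_lt.
pose e := z / D.
have e0 : 0 < e by rewrite divr_gt0.
have e1 : e < 1 by rewrite ltr_pdivrMr// mul1r.
have zE : e * D = z by rewrite divfK// gt_eqF.
pose L' k := (1 - e) * L k + e * D.
have L'0 k : 0 < L' k.
  by rewrite /L' zE ltr_wpDl// mulr_ge0 ?optimal_ge0// subr_ge0 ltW.
have fL' : feasible N L'.
  split=> [k|j]; first exact: ltW.
  rewrite big_split /= -!mulr_sumr.
  have -> : cap N j = (1 - e) * cap N j + e * cap N j by ring.
  apply: lerD; apply: ler_wpM2l;
    [by rewrite subr_ge0 ltW|exact: optimal_cap|exact: ltW|exact: Dcap].
have := Lopt.2 _ fL'; rewrite system_objective_gt0// objE lee_fin => obj.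
have lower k : a k - e * `|U k D - a k| <= U k (L' k).
  have := optimal_ge0 k; rewrite le_eqVlt => /orP[/eqP Lk|Lk].
    have : a k <= U k z.
      rewrite -lee_fin /a fineK// -Lk; exact: utility_ext0_le_value.
    rewrite /L' -Lk mulr0 add0r zE => h; apply: le_trans h.
    by rewrite lerBlDr lerDl mulr_ge0// ltW.
  have aE : a k = U k (L k) by rewrite /a utility_ext_gt0.
  have := ler_norm (- (U k D - a k)); rewrite normrN => nrm.
  have [LD|LD] := eqVneq (L k) D.
    by rewrite /L' aE LD -mulrDl subrK mul1r subrr normr0 mulr0 subr0.
  have e01 : 0 < 1 - e < 1 by apply/andP; split; lra.
  have := utility_concave (HU k) Lk D0 LD e01; rewrite -aE.
  have -> : 1 - (1 - e) = e by ring.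
  rewrite -/(L' k); nra.
have loweri : a i + z * (K / D + 1) <= U i (L' i).
  rewrite /L' Li0 mulr0 add0r zE.
  have : a i <= U i z - z * (U i)^`()%classic z.
    rewrite -lee_fin /a fineK// Li0; exact: utility_ext0_le.
  have := ler_wpM2l (ltW z0) Uz; lra.
have : \sum_k a k - e * K + z * (K / D + 1) <= \sum_k U k (L' k).
  rewrite /K mulr_sumr -sumrB (bigD1 i)//= [leRHS](bigD1 i)//= addrAC.
  apply: lerD; last by apply: ler_sum => k _; exact: lower.
  apply: le_trans loweri; rewrite lerD2r lerBlDr lerDl mulr_ge0// ltW//.
have -> : z * (K / D + 1) = e * K + z by rewrite /e; field; rewrite gt_eqF.
lra.
Unshelve. all: by end_near. Qed.

Let u i := (U i)^`()%classic (L i).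

Definition saturated j := \sum_(i | j \in route N i) L i == cap N j.

(** Only saturated queues carry a price, so complementary slackness with the capacities is built
    into the projection. *)
Definition load (q : J -> R) i := \sum_(j | (j \in route N i) && saturated j) q j.

(* An ascent direction that is tangent to the saturated constraints stays
   feasible for a short time, so it cannot exist at the optimum. *)
Lemma no_ascent_direction (v : I -> R) :
  (forall j, saturated j -> \sum_(i | j \in route N i) v i <= 0) ->
  \sum_i u i * v i <= 0.
Proof.
move=> vsat; rewrite leNgt; apply/negP => gain.
set A := \sum_i u i * v i in gain.
pose S := \sum_i `|v i|.
have S0 : 0 <= S by apply: sumr_ge0.
(* With this precision the linearisation errors sum to at most half of the gain [t * A]. *)
have e0 : 0 < A / 2 / (S + 1) by rewrite !divr_gt0// ltr_wpDl.
have /choice[r Hr] : forall i, exists r, 0 < r /\ forall h, `|h| < r ->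
   `|U i (L i + h) - U i (L i) - u i * h| <= A / 2 / (S + 1) * `|h|.
  move=> i; have [r r0 H] := derive1_approx (utility_derivable (HU i) (optimal_gt0 i)) e0.
  by exists r; split.
have H1 : \forall t \near 0^'+, forall i, 0 + t * `|v i| < r i.
  apply: filter_forall => i; apply: near_right_lt_affine; exact: (Hr i).1.
have H2 : \forall t \near 0^'+, forall i, - L i + t * - v i < 0.
  apply: filter_forall => i; apply: near_right_lt_affine.
  by rewrite oppr_lt0 optimal_gt0.
have H3 : \forall t \near 0^'+, forall j, ~~ saturated j ->
    \sum_(i | j \in route N i) L i + t * \sum_(i | j \in route N i) v i < cap N j.
  apply: filter_forall => j; have [sj|nsj] := boolP (saturated j).
    by apply: nearW.
  have := @near_right_lt_affine R (\sum_(i | j \in route N i) L i)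
    (\sum_(i | j \in route N i) v i) (cap N j).
  rewrite lt_neqAle nsj optimal_cap => /(_ isT).
  by apply: filterS.
near (0 : R)^'+ => t.
have t0 : 0 < t by near: t; exact: nbhs_right_gt.
have K1 : forall i, 0 + t * `|v i| < r i by near: t.
have K2 : forall i, - L i + t * - v i < 0 by near: t.
have K3 : forall j, ~~ saturated j ->
  \sum_(i | j \in route N i) L i + t * \sum_(i | j \in route N i) v i < cap N j.
  by near: t.
pose L' i := L i + t * v i.
have L'0 i : 0 < L' i by have := K2 i; rewrite /L'; lra.
have fL' : feasible N L'.
  split=> [i|j]; first exact: ltW.
  rewrite big_split /= -mulr_sumr.
  have [sj|nsj] := boolP (saturated j); last exact/ltW/K3.
  rewrite (eqP sj) gerDl pmulr_rle0//; exact: vsat.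
have := Lopt.2 _ fL'; rewrite !system_objective_gt0//; last exact: optimal_gt0.
rewrite lee_fin leNgt => /negP; apply.
have : \sum_i (U i (L i) + t * (u i * v i) - A / 2 / (S + 1) * (t * `|v i|)) <=
   \sum_i U i (L' i).
  apply: ler_sum => i _; have := (Hr i).2 (t * v i).
  rewrite normrM (gtr0_norm t0) => /(_ _)/ler_normlP[|H _].
    by have := K1 i; rewrite add0r.
  by rewrite /L'; nra.
apply: lt_le_trans; rewrite sumrB big_split /= -!mulr_sumr -/A -/S -addrA ltrDl.
have -> : A / 2 / (S + 1) * (t * S) = t * (A / 2 * (S / (S + 1))).
  by field; rewrite gt_eqF// ltr_wpDl.
rewrite -mulrBr mulr_gt0// subr_gt0.
have : S / (S + 1) <= 1 by rewrite ler_pdivrMr ?mul1r ?lerDl// ltr_wpDl.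
nra.
Unshelve. all: by end_near. Qed.

(* The residual of the projection of the gradient onto the cone spanned by the
   saturated constraints would be an ascent direction. *)
Lemma multipliers_exist : exists q : J -> R,
  [/\ forall j, 0 <= q j, forall j, q j != 0 -> saturated j &
      forall i, u i = \sum_(j | j \in route N i) q j].
Proof.
have u0 i : 0 < u i by apply: utility_derive_gt0 => //; exact: optimal_gt0.
(* The box makes the minimisation compact. Its upper face is harmless: when [q j] reaches [B], every
   route through [j] has load at least [u i], so its residual is nonpositive. *)
pose B := \sum_i u i.
have uB i : u i <= B by rewrite /B (bigD1 i)//= lerDl sumr_ge0// => k _; exact: ltW.
have B0 : 0 <= B by apply: sumr_ge0 => i _; exact: ltW.
pose psi (q : J -> R) := \sum_i (u i - load q i) ^+ 2.
have [q qbox qmin] : exists2 q, (forall j, 0 <= q j <= B) &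
    forall q', (forall j, 0 <= q' j <= B) -> psi q <= psi q'.
  apply: (@box_min _ _ B [set q | forall j, 0 <= q j <= B] psi) => //.
  - exact: closed_box.
  - apply: continuous_sumr => i v.
    have hc : {for v, continuous (fun v => u i - load (row_fun v) i)}.
      apply: continuousB; first exact: cst_continuous.
      by apply: continuous_sumr => j; exact: row_fun_continuous.
    exact: (continuousM hc hc).
  - by exists (fun=> 0) => j; rewrite lexx B0.
pose v i := u i - load q i.
pose Av j := \sum_(i | j \in route N i) v i.
(* The objective [psi] is quadratic along coordinate [j]; this is its minimality at [q] for any
   admissible shift, of either sign. *)
have step j t : saturated j -> 0 <= q j + t <= B ->
    2 * t * Av j <= t ^+ 2 * \sum_(i | j \in route N i) 1.
  move=> sj qt; pose q' k := q k + (if k == j then t else 0).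
  have := qmin q' => H; have : psi q <= psi q'.
    by apply: H => k; rewrite /q'; case: eqP => [->//|_]; rewrite addr0.
  have loadE i : load q' i = load q i + (if j \in route N i then t else 0).
    rewrite /load big_split /=; congr (_ + _); rewrite -big_mkcondr /=.
    case: ifP => ji.
      by rewrite (eq_bigl (pred1 j)) ?big_pred1_eq// => k /=; case: eqP => [->|];
        rewrite ?andbF ?ji ?sj.
    by rewrite big_pred0// => k; case: eqP => [->|]; rewrite ?andbF ?ji.
  have : psi q' = psi q - 2 * t * Av j + t ^+ 2 * \sum_(i | j \in route N i) 1.
    rewrite /psi /Av !mulr_sumr !(big_mkcond (fun i => j \in route N i)) -sumrB.
    rewrite -big_split; apply: eq_bigr => i _ /=.
    rewrite loadE /v; case: ifP => _; ring.
  lra.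
have Av_le0 j : saturated j -> Av j <= 0.
  move=> sj; have /andP[qj0 qjB] := qbox j.
  rewrite leNgt; apply/negP => Avp.
  have qltB : q j < B.
    rewrite ltNge; apply/negP => Bq; move: Avp; apply/negP; rewrite -leNgt.
    apply: sumr_le0 => i ji; rewrite /v subr_le0 (le_trans (uB i))//.
    rewrite (le_trans Bq)// /load (bigD1 j) ?ji//= lerDl sumr_ge0// => k _.
    by have /andP[] := qbox k.
  set n := \sum_(i | j \in route N i) (1 : R) in step *.
  have := step j; rewrite -/n => {}step.
  have n0 : 0 <= n by apply: sumr_ge0.
  pose t := Num.min (B - q j) (Av j / (n + 1)).
  have t0 : 0 < t by rewrite lt_min subr_gt0 qltB divr_gt0// ltr_wpDl.
  have tB : t <= B - q j by rewrite ge_min lexx.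
  have tA : t * (n + 1) <= Av j.
    by rewrite -ler_pdivlMr ?ltr_wpDl// ge_min lexx orbT.
  have := step t sj; rewrite (_ : 0 <= q j + t <= B); last by apply/andP; split; lra.
  move=> /(_ isT); nra.
have Av_eq0 j : saturated j -> q j * Av j = 0.
  move=> sj; have /andP[qj0 qjB] := qbox j.
  apply/eqP; rewrite eq_le mulr_ge0_le0 ?Av_le0//=.
  rewrite leNgt; apply/negP => lt0.
  have qj : 0 < q j by rewrite lt_def qj0 andbT; apply: contraTneq lt0 => ->; rewrite mul0r ltxx.
  have Avn : Av j < 0 by move: lt0; rewrite pmulr_rlt0.
  have := step j; set n := \sum_(i | j \in route N i) (1 : R) => {}step.
  have n0 : 0 <= n by apply: sumr_ge0.
  pose t := Num.min (q j) (- Av j / (n + 1)).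
  have t0 : 0 < t by rewrite lt_min qj divr_gt0 ?ltr_wpDl ?oppr_gt0.
  have tB : t <= q j by rewrite ge_min lexx.
  have tA : t * (n + 1) <= - Av j.
    by rewrite -ler_pdivlMr ?ltr_wpDl// ge_min lexx orbT.
  have := step (- t) sj; rewrite (_ : 0 <= q j - t <= B); last by apply/andP; split; lra.
  move=> /(_ isT); nra.
(* Slackness makes the residual [v] orthogonal to the projection, so its squared norm equals its
   product with the gradient, which [no_ascent_direction] bounds by 0. *)
have orth : \sum_i v i * load q i = 0.
  rewrite /load; under eq_bigr do rewrite mulr_sumr.
  rewrite (exchange_big_dep saturated)/=; last by move=> i j _ /andP[].
  rewrite big1// => j sj; rewrite -[RHS](Av_eq0 _ sj) /Av mulr_sumr.
  by apply: eq_big => i; [rewrite sj andbT|rewrite mulrC].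
have v2 : \sum_i v i ^+ 2 <= 0.
  have -> : \sum_i v i ^+ 2 = \sum_i u i * v i.
    apply/esym; transitivity (\sum_i v i ^+ 2 + \sum_i v i * load q i).
      by rewrite -big_split; apply: eq_bigr => i _ /=; rewrite /v; ring.
    by rewrite orth addr0.
  exact: no_ascent_direction.
have v0 i : v i = 0.
  apply/eqP; rewrite -sqrf_eq0; apply/eqP.
  have /psumr_eq0P : forall i, true -> 0 <= v i ^+ 2 by move=> k _; exact: sqr_ge0.
  by apply => //; apply/eqP; rewrite eq_le v2 sumr_ge0// => k _; exact: sqr_ge0.
exists (fun j => if saturated j then q j else 0); split=> [j|j|i].
- by case: ifP => // _; have /andP[] := qbox j.
- by case: ifP => //; rewrite eqxx.
- have /eqP := v0 i; rewrite subr_eq0 => /eqP ->.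
  by rewrite /load big_mkcondr.
Qed.

End KKT.

(** * Distance to the limit set *)

Lemma continuous_normr (R : realType) (T : topologicalType) (f : T -> R) :
  continuous f -> continuous (fun x => `|f x|).
Proof. by move=> fc x; apply: (continuous_comp (fc x)); exact: norm_continuous. Qed.

Section ResidualDistance.
Context (R : realType) (J I : finType) (N : network R J I).
Context (L x : I -> R) (A : set {ffun incidence N -> R}).

Definition balance_residual (m : {ffun incidence N -> R}) (k : incidence N) : R :=
  m k * cap N (sval k).1 - queue_total m (sval k).1 * L (sval k).2.

Definition window_residual (m : {ffun incidence N -> R}) (i : I) : R :=
  window_total m i - x i.

Hypothesis HA : forall m : {ffun incidence N -> R}, (forall k, 0 <= m k) ->
  (forall k, balance_residual m k = 0) -> (forall i, window_residual m i = 0) ->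
  A m.

Let psi (f : incidence N -> R) : R :=
  \sum_k `|balance_residual (finfun f) k| + \sum_i `|window_residual (finfun f) i|.

Let psi_continuous : continuous (fun v => psi (row_fun v)).
Proof.
have qc j : continuous (fun v : 'rV[R]_#|incidence N| => queue_total (finfun (row_fun v)) j).
  rewrite (_ : (fun v => _) =
    fun v : 'rV[R]_#|incidence N| => \sum_(k : incidence N | (sval k).1 == j) row_fun v k).
    by apply: continuous_sumr => k; exact: row_fun_continuous.
  by apply/funext => v; apply: eq_bigr => k _; rewrite ffunE.
have wc i : continuous (fun v : 'rV[R]_#|incidence N| => window_total (finfun (row_fun v)) i).
  rewrite (_ : (fun v => _) =
    fun v : 'rV[R]_#|incidence N| => \sum_(k : incidence N | (sval k).2 == i) row_fun v k).
    by apply: continuous_sumr => k; exact: row_fun_continuous.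
  by apply/funext => v; apply: eq_bigr => k _; rewrite ffunE.
have mc (k : incidence N) : continuous (fun v : 'rV[R]_#|incidence N| => (finfun (row_fun v) : {ffun _ -> _}) k).
  rewrite (_ : (fun v => _) = fun v : 'rV[R]_#|incidence N| => row_fun v k).
    exact: row_fun_continuous.
  by apply/funext => v; rewrite ffunE.
move=> v; apply: continuousD; apply: continuous_sumr => k; apply: continuous_normr => {}v.
  have c1 := continuousM (mc k v) (@cst_continuous _ _ (cap N (sval k).1) v).
  have c2 := continuousM (qc (sval k).1 v) (@cst_continuous _ _ (L (sval k).2) v).
  exact: (continuousB c1 c2).
exact: (continuousB (wc k v) (@cst_continuous _ _ (x k) v)).
Qed.


(** The points of a box at distance at least [eps] from [A] form a compact set. The total residual
    attains a minimum there, and a zero minimum would put the minimiser in [A]. *)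
Lemma dist_lt_of_residuals eps : 0 < eps -> exists2 eta, 0 < eta &
  forall m : {ffun incidence N -> R}, (forall k, 0 <= m k) ->
    (forall k, `|balance_residual m k| <= eta) ->
    (forall i, `|window_residual m i| <= eta) ->
    (dist_to A m < eps%:E)%E.
Proof.
move=> eps0.
(* Coordinates are nonnegative and add up to window totals, so window residuals at most 1 confine
   them to this box. *)
pose B := \sum_i (`|x i| + 1).
pose far (f : incidence N -> R) :=
  forall a, A a -> eps ^+ 2 <= \sum_k (f k - a k) ^+ 2.
pose E := [set f : incidence N -> R | (forall k, 0 <= f k <= B) /\ far f].
have clE : closed [set v | E (row_fun v)].
  rewrite (_ : mkset _ = [set v | forall k, 0 <= row_fun v k <= B] `&`
    \bigcap_(a in A) ((fun v => \sum_k (row_fun v k - a k) ^+ 2) @^-1`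
       [set y | eps ^+ 2 <= y])).
    apply: closedI; first exact: closed_box.
    apply: closed_bigI => a _; apply: preimage_closed; last exact: closed_ge.
    move=> v _; apply: continuous_sumr => k {}v.
    have hc : {for v, continuous (fun v => row_fun v k - a k)}.
      by apply: continuousB; [exact: row_fun_continuous|exact: cst_continuous].
    exact: (continuousM hc hc).
  by apply/seteqP; split=> v.
have near (m : {ffun incidence N -> R}) : (forall k, 0 <= m k) ->
    (forall i, `|window_residual m i| <= 1) -> ~ E (m : _ -> _) -> (dist_to A m < eps%:E)%E.
  move=> m0 w1 nE.
  have mB k : 0 <= m k <= B.
    rewrite m0 /=; apply: (@le_trans _ _ (window_total m (sval k).2)).
      by rewrite /window_total (bigD1 k)//= lerDl sumr_ge0.
    apply: (@le_trans _ _ (`|x (sval k).2| + 1)).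
      have /ler_normlP[_] := w1 (sval k).2; rewrite /window_residual.
      by have := ler_norm (x (sval k).2); lra.
    by rewrite /B (bigD1 (sval k).2)//= lerDl sumr_ge0.
  have /existsNP[a /not_implyP[Aa /negP]] : ~ far m by move=> fm; apply: nE.
  rewrite -ltNge => lt.
  apply: (@le_lt_trans _ _ (enorm [ffun k => m k - a k])%:E).
    by apply: ereal_inf_lbound; exists a.
  rewrite lte_fin /enorm -[eps]ger0_norm ?ltW// -sqrtr_sqr ltr_sqrt ?exprn_gt0//.
  by under eq_bigr do rewrite ffunE.
have [E0|/set0P/negP] := pselect (E !=set0); last first.
  rewrite negbK => /eqP E0; exists 1 => // m m0 _ w1; apply: near => //.
  by rewrite E0.
have [f0 [f0B f0far] f0min] := box_min clE psi_continuous (fun m h => h.1) E0.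
have psi0 : 0 < psi f0.
  have s1 : 0 <= \sum_k `|balance_residual (finfun f0) k| by apply: sumr_ge0.
  have s2 : 0 <= \sum_i `|window_residual (finfun f0) i| by apply: sumr_ge0.
  rewrite lt_def addr_ge0// andbT; apply/negP => /eqP /eqP.
  rewrite paddr_eq0// => /andP[]; rewrite !psumr_eq0// => /allP b0 /allP w0.
  have Af0 : A (finfun f0).
    apply: HA => [k|k|i]; first by rewrite ffunE; have /andP[] := f0B k.
      by apply/eqP; rewrite -normr_eq0; apply: b0; rewrite mem_index_enum.
    by apply/eqP; rewrite -normr_eq0; apply: w0; rewrite mem_index_enum.
  have := f0far _ Af0; rewrite big1 => [|k _]; last by rewrite ffunE subrr expr0n.
  by rewrite leNgt exprn_gt0.
pose n : R := \sum_(k : incidence N) 1 + \sum_(i : I) 1.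
have n0 : 0 <= n by rewrite addr_ge0// sumr_ge0.
exists (Num.min 1 (psi f0 / 2 / (n + 1))) => [|m m0 bm wm].
  by rewrite lt_min ltr01 !divr_gt0// ltr_wpDl.
have wm1 i : `|window_residual m i| <= 1.
  by apply: le_trans (wm i) _; rewrite ge_min lexx.
apply: near => // Em; have := f0min m Em.
have -> : psi m = \sum_k `|balance_residual m k| + \sum_i `|window_residual m i|.
  by rewrite /psi (_ : finfun m = m)//; apply/ffunP => k; rewrite ffunE.
apply/negP; rewrite -ltNge.
set e := Num.min _ _ in bm wm.
have eP : e * (n + 1) <= psi f0 / 2.
  by rewrite -ler_pdivlMr ?ltr_wpDl// ge_min lexx orbT.
have e0 : 0 < e by rewrite lt_min ltr01 !divr_gt0// ltr_wpDl.
have : \sum_k `|balance_residual m k| + \sum_i `|window_residual m i| <= e * n.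
  by rewrite mulrDr !mulr_sumr; apply: lerD; apply: ler_sum => k _; rewrite mulr1.
nra.
Qed.

End ResidualDistance.

(** * Exponential tilting *)

Lemma expR_le_quadratic (R : realType) (t : R) :
  `|t| <= 2^-1 -> expR t <= 1 + t + 2 * t ^+ 2.
Proof.
move=> /ler_normlP[tm tp].
have h : 1 - t <= expR (- t) by have := expR_ge1Dx (- t).
have : expR t * expR (- t) = 1 by rewrite expRxMexpNx_1.
have := expR_gt0 t; have : 0 < 1 - t by lra.
set E := expR t; set E' := expR (- t) in h * => a b c.
have EE : E * (1 - t) <= 1 by rewrite -[leRHS]c ler_pM2l.
have : 1 <= (1 + t + 2 * t ^+ 2) * (1 - t).
  have : 0 <= t ^+ 2 * (1 - 2 * t) by rewrite mulr_ge0 ?sqr_ge0//; lra.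
  by rewrite expr2; lra.
move=> h2; rewrite -(ler_pM2r a); exact: le_trans EE h2.
Qed.

(** The moment generating function of a centred indicator: the first-order term cancels. A total
    mass below 1 is allowed, as it occurs at queues that are not saturated. *)
Lemma chernoff_factor (R : realType) (I : finType) (Q : pred I) (p : I -> R)
    (i0 : I) (t : R) :
  (forall i, 0 <= p i) -> \sum_(i | Q i) p i <= 1 -> Q i0 -> `|t| <= 2^-1 ->
  \sum_(i | Q i) p i * expR (t * ((i == i0)%:R - p i0)) <= expR (2 * t ^+ 2).
Proof.
move=> p0 p1 Qi0 t2.
have -> : \sum_(i | Q i) p i * expR (t * ((i == i0)%:R - p i0)) =
   expR (- (t * p i0)) * (\sum_(i | Q i) p i + p i0 * (expR t - 1)).
  rewrite (bigD1 i0)//= [in RHS](bigD1 i0)//= eqxx.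
  have -> : \sum_(i | Q i && (i != i0)) p i * expR (t * ((i == i0)%:R - p i0)) =
     expR (- (t * p i0)) * \sum_(i | Q i && (i != i0)) p i.
    rewrite mulr_sumr; apply: eq_bigr => i /andP[_ /negbTE ->].
    by rewrite sub0r mulrN mulrC.
  by rewrite mulrBr mulr1 expRD; ring.
have pi1 : p i0 <= 1.
  by apply: le_trans p1; rewrite (bigD1 i0)//= lerDl sumr_ge0.
have := expR_le_quadratic t2.
have := expR_ge1Dx (p i0 * (expR t - 1)).
have := expR_gt0 (- (t * p i0)).
set E := expR (- _); set F := expR (_ * (_ - _)) => E0 hF hq.
apply: (@le_trans _ _ (E * F)); first by apply: ler_wpM2l; [exact: ltW|lra].
rewrite /E /F -expRD ler_expR.
have := p0 i0; have := sqr_ge0 t; nra.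
Qed.

Section Incidence.
Context (R : realType) (J I : finType) (N : network R J I).
Implicit Types (s : state N).

Lemma sum_incidence_queue (j : J) (F : J -> I -> R) :
  \sum_(k : incidence N | (sval k).1 == j) F (sval k).1 (sval k).2 =
  \sum_(i | j \in route N i) F j i.
Proof.
rewrite -(big_sub_cond [pred p : J * I | p.1 \in route N p.2]
   (fun p => p.1 == j) (fun p => F p.1 p.2)).
rewrite (reindex_onto (fun i => (j, i)) snd) /=; last first.
  by move=> [j' i] /= /andP[_ /eqP <-].
by apply: eq_bigl => i; rewrite !inE /= !eqxx !andbT.
Qed.

Lemma sum_incidence_window (i : I) (F : J -> I -> R) :
  \sum_(k : incidence N | (sval k).2 == i) F (sval k).1 (sval k).2 =
  \sum_(j | j \in route N i) F j i.
Proof.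
rewrite -(big_sub_cond [pred p : J * I | p.1 \in route N p.2]
   (fun p => p.2 == i) (fun p => F p.1 p.2)).
rewrite (reindex_onto (fun j => (j, i)) fst) /=; last first.
  by move=> [j i'] /= /andP[_ /eqP <-].
by apply: eq_bigl => j; rewrite !inE /= !eqxx !andbT.
Qed.

Lemma sum_word (w : seq I) (f : I -> R) :
  \sum_(i <- w) f i = \sum_i (count_mem i w)%:R * f i.
Proof.
elim: w => [|i w IH]; first by rewrite big_nil big1// => i _; rewrite mul0r.
rewrite big_cons IH /=; under [RHS]eq_bigr do rewrite natrD mulrDl.
rewrite big_split /=; congr (_ + _).
rewrite (bigD1 i)//= eqxx mul1r big1 ?addr0// => k /negbTE.
by rewrite eq_sym => ->; rewrite mul0r.
Qed.

Lemma sum_const_word (w : seq I) (c : R) : \sum_(i <- w) c = (size w)%:R * c.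
Proof. by rewrite big_const_seq count_predT iter_addr addr0 mulr_natl. Qed.

Lemma count_off_route s j i : j \notin route N i -> count_mem i (word s j) = 0%N.
Proof.
move=> ji; apply/count_memPn; apply: contra ji => iw.
by have /forallP/(_ j)/allP := valid_state s; apply.
Qed.

Lemma sum_words_wcount s (f : I -> R) :
  \sum_j \sum_(i <- word s j) f i = \sum_i (wcount N (sval s) i)%:R * f i.
Proof.
under eq_bigr do rewrite sum_word.
rewrite exchange_big; apply: eq_bigr => i _ /=; rewrite -mulr_suml; congr (_ * _).
rewrite /wcount natr_sum [RHS]big_mkcond; apply: eq_bigr => j _ /=.
by case: ifPn => // ji; rewrite (count_off_route s ji).
Qed.

Lemma size_word_sum s j :
  (size (word s j))%:R = \sum_(i | j \in route N i) (count_mem i (word s j))%:R :> R.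
Proof.
rewrite -[LHS]mulr1 -sum_const_word sum_word.
rewrite [RHS]big_mkcond; apply: eq_bigr => i _ /=; rewrite mulr1.
by case: ifPn => // ji; rewrite (count_off_route s ji).
Qed.

Lemma word_prod_tilt (p b : J -> I -> R) (x : words J I) :
  word_prod (fun j i => p j i * expR (b j i)) x =
  word_prod p x * expR (\sum_j \sum_(i <- x j) b j i).
Proof.
rewrite /word_prod expR_sum -big_split; apply: eq_bigr => j _ /=.
by rewrite big_split expR_sum.
Qed.

Lemma sum_tilt (b : R) (e : J * I) (t r : R) (x : words J I) :
  \sum_j \sum_(i <- x j)
    (b + (if j == e.1 then t * ((i == e.2)%:R - r) else 0)) =
  b * \sum_j (size (x j))%:R
  + t * ((count_mem e.2 (x e.1))%:R - (size (x e.1))%:R * r).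
Proof.
under eq_bigr do rewrite big_split /=.
rewrite big_split /= mulr_sumr; congr (_ + _).
  by apply: eq_bigr => j _; rewrite sum_const_word mulrC.
rewrite (bigD1 e.1)//= [X in _ + X]big1 ?addr0 => [|j /negbTE je]; last first.
  by rewrite big1// => i _; rewrite je.
rewrite eqxx -mulr_sumr sumrB; congr (_ * (_ - _)).
  by rewrite sum_word (bigD1 e.2)//= eqxx mulr1 big1 ?addr0// => i /negbTE ->;
    rewrite mulr0.
by rewrite sum_const_word.
Qed.

End Incidence.

(** * Concentration *)

Section Concentration.
Context (R : realType) (J I : finType) (N : network R J I).
Context (U : I -> R -> R) (d : I -> nat -> R) (L : I -> R) (D : I -> R).
Hypothesis HU : forall i, is_utility (U i).
Hypothesis HA1 : forall i, assumption1 (U i).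
Hypothesis HA2 : forall i, assumption2 (U i).
Hypothesis HD : forall i (c : nat), (0 < c)%N -> `|d i c| <= D i.
Hypothesis Hddef : forall i (c : nat), (0 < c)%N ->
  scaled_window_defined (U i) c (d i c).
Hypothesis Lopt : system_optimal N U L.
Implicit Types (c : nat) (i : I) (j : J) (s : state N).

Definition window_target i := L i * (U i)^`()%classic (L i).

Definition scaled_weight c s :=
  weight N (fun i k => scaled_window_fun (U i) c (d i c) k) (sval s).

Definition load_fraction j i := L i / cap N j.

Definition window_gap i y := window_fun (U i) y - y * ln (L i) + U i (L i).

Definition total_gap c s :=
  \sum_i c%:R * window_gap i (scaled_arg c (d i c) (wcount N (sval s) i)).

(** The state-independent factor of the weight: the [ln (L i)] of each packet has gone into
    [load_fraction], and the terms in [d] come from the shift in [scaled_arg]. It cancels from every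
    probability. *)
Definition peak_weight c :=
  expR (\sum_i (d i c * ln (L i) - c%:R * U i (L i))).

Definition population s : R := \sum_j (size (word s j))%:R.

Let L0 i : 0 < L i. Proof. exact: optimal_gt0 HU Lopt i. Qed.

Let x_gt0 i : 0 < window_target i.
Proof. exact: target_window_gt0. Qed.

Lemma load_fraction_ge0 j i : 0 <= load_fraction j i.
Proof. by rewrite divr_ge0// ltW// cap_gt0. Qed.

Lemma load_fraction_sum_le1 j : \sum_(i | j \in route N i) load_fraction j i <= 1.
Proof.
rewrite -mulr_suml ler_pdivrMr ?cap_gt0// mul1r; exact: optimal_cap Lopt j.
Qed.

Lemma scaled_arg_fin c s i : (0 < c)%N ->
  window_fun_ext (U i) (scaled_arg c (d i c) (wcount N (sval s) i)) \is a fin_num.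
Proof. by move=> c0; have [] := Hddef i c0 (wcount N (sval s) i). Qed.

Lemma scaled_argE c s i : (0 < c)%N ->
  c%:R * scaled_arg c (d i c) (wcount N (sval s) i) =
  (wcount N (sval s) i)%:R + d i c.
Proof. by move=> c0; rewrite /scaled_arg; field; rewrite pnatr_eq0 -lt0n. Qed.

(* The last factor is the probability that each packet at queue j is of route i
   with probability [L i / cap N j], independently of the others. *)
Lemma scaled_weightE c s : (0 < c)%N ->
  scaled_weight c s =
  peak_weight c * (expR (total_gap c s) * word_prod load_fraction (sval s)).
Proof.
move=> c0; rewrite /scaled_weight /weight.
have -> : word_prod load_fraction (sval s) =
    word_prod (fun j i => (cap N j)^-1 * expR (ln (L i))) (sval s).
  apply: eq_bigr => j _; apply: eq_bigr => i _.
  by rewrite lnK ?posrE// mulrC.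
rewrite (word_prod_tilt (fun j _ => (cap N j)^-1) (fun _ i => ln (L i))).
rewrite sum_words_wcount.
have -> : word_prod (fun j (_ : I) => (cap N j)^-1) (sval s) =
    \prod_j (cap N j)^-1 ^+ size (sval s j).
  by apply: eq_bigr => j _; rewrite big_const_seq count_predT iter_mulr_1.
set P := \prod_j _; rewrite [P * _]mulrC !mulrA; congr (_ * _).
rewrite /peak_weight -!expRD; congr expR; rewrite /total_gap -!big_split /=.
apply: eq_bigr => i _; rewrite /scaled_window_fun /window_gap mulrDr mulrBr.
rewrite [c%:R * (_ * _)]mulrA scaled_argE//; ring.
Qed.

(** The exponential Markov inequality: on [A] the gap is bounded by a constant plus a sum over the
    packets, then [A] is enlarged to all states. The packet terms tilt the load fractions, and each
    queue becomes a geometric series of ratio at most [r]. *)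
Lemma event_bound c (A : set (state N)) (b : J -> I -> R) (E r : R) :
  (0 < c)%N -> 0 <= r < 1 ->
  (forall s, A s -> total_gap c s <= E + \sum_j \sum_(i <- word s j) b j i) ->
  (forall j, \sum_(i | j \in route N i) load_fraction j i * expR (b j i) <= r) ->
  (\esum_(s in A) (scaled_weight c s)%:E <=
    (peak_weight c * (expR E * (1 - r)^-1 ^+ #|J|))%:E)%E.
Proof.
move=> c0 r01 AE br.
pose a j i := load_fraction j i * expR (b j i).
have a0 j i : 0 <= a j i by rewrite mulr_ge0 ?load_fraction_ge0 ?expR_ge0.
have C0 : 0 <= peak_weight c * expR E by rewrite mulr_ge0 ?expR_ge0.
apply: (@le_trans _ _ (\esum_(s in [set: state N])
   ((peak_weight c * expR E) * word_prod a (sval s))%:E)%E).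
  apply: (@le_trans _ _ (\esum_(s in A)
     ((peak_weight c * expR E) * word_prod a (sval s))%:E)%E).
    apply: le_esum => s As; rewrite lee_fin scaled_weightE// -mulrA.
    rewrite ler_wpM2l ?expR_ge0// word_prod_tilt [leRHS]mulrCA -expRD.
    have W0 := word_prod_ge0 load_fraction_ge0 (sval s).
    by rewrite mulrC ler_wpM2l// ler_expR; exact: AE.
  exact: esum_subset.
rewrite esumZl//; last by move=> s; exact: word_prod_ge0.
rewrite mulrA [in leRHS]EFinM; apply: lee_wpmul2l; first by rewrite lee_fin.
exact: word_prod_total.
Qed.

Lemma gap_bounds eta : 0 < eta -> exists2 kappa, 0 < kappa &
  forall i y, window_fun_ext (U i) y \is a fin_num ->
  [/\ window_gap i y <= 0,
      window_gap i y <= - kappa * (y - window_target i - eta) &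
      eta <= `|y - window_target i| ->
      window_gap i y <= - kappa * `|y - window_target i|].
Proof.
move=> eta0.
have /choice[K HK] : forall i, exists k, 0 < k /\
    forall y, window_fun_ext (U i) y \is a fin_num ->
    eta <= `|y - window_target i| -> window_gap i y <= - k * `|y - window_target i|.
  by move=> i; have [k k0 H] := window_gap_linear (HU i) (L0 i) eta0; exists k; split.
have H : \forall t \near 0^'+, forall i, t <= K i.
  by apply: filter_forall => i; apply: nbhs_right_ltW; exact: (HK i).1.
near (0 : R)^'+ => t.
have t0 : 0 < t by near: t; exact: nbhs_right_gt.
have tK : forall i, t <= K i by near: t.
exists t => // i y yf.
have g0 : window_gap i y <= 0 by exact: window_gap_le0.
have g2 : eta <= `|y - window_target i| ->
      window_gap i y <= - t * `|y - window_target i|.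
  move=> h; apply: le_trans ((HK i).2 y yf h) _.
  by rewrite !mulNr lerN2 ler_wpM2r.
split => //; have [yx|yx] := leP eta (y - window_target i).
  have := g2 (le_trans yx (ler_norm _)); rewrite ger0_norm; nra.
nra.
Unshelve. all: by end_near. Qed.

Lemma D_ge0 i : 0 <= D i.
Proof. exact: le_trans (normr_ge0 _) (HD i (ltn0Sn 0)). Qed.

(** What remains when slopes in the single windows are traded for one slope in the population; [D i]
    absorbs the shift [d i c]. *)
Definition drift_bound (eta : R) : R := \sum_i (window_target i + eta + D i).

Lemma drift_bound_ge0 eta : 0 < eta -> 0 <= drift_bound eta.
Proof.
move=> eta0; apply: sumr_ge0 => i _.
by rewrite !addr_ge0 ?D_ge0// ltW.
Qed.

Lemma population_wcount s : population s = \sum_i (wcount N (sval s) i)%:R.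
Proof.
have := @sum_words_wcount _ _ _ N s (fun=> 1 : R).
rewrite /population; under eq_bigr do rewrite sum_const_word mulr1.
by move=> ->; apply: eq_bigr => i _; rewrite mulr1.
Qed.

Lemma total_gap_split theta eta c s (F : I -> R) : (0 < c)%N ->
  0 <= theta ->
  (forall i, let y := scaled_arg c (d i c) (wcount N (sval s) i) in
    window_gap i y <= F i - theta * (y - window_target i - eta)) -> 0 < eta ->
  total_gap c s <= c%:R * (\sum_i F i) + theta * c%:R * drift_bound eta
    - theta * population s.
Proof.
move=> c0 th0 H eta0; rewrite population_wcount /total_gap /drift_bound !mulr_sumr.
rewrite -big_split /= -sumrB; apply: ler_sum => i _.
have c1 : 1 <= c%:R :> R by rewrite ler1n.
have := H i => /=; have := scaled_argE s i c0.
set y := scaled_arg _ _ _; set k := (wcount _ _ _)%:R => yE Hi.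
have /ler_normlP[dm _] := HD i c0.
have Dc : D i <= c%:R * D i by rewrite ler_peMl// D_ge0.
apply: (@le_trans _ _ (c%:R * (F i - theta * (y - window_target i - eta)))).
  by rewrite ler_wpM2l.
have -> : c%:R * (F i - theta * (y - window_target i - eta)) =
  c%:R * F i - theta * (c%:R * y - c%:R * (window_target i + eta)) by ring.
rewrite yE.
have : 0 <= theta * (c%:R * D i + d i c) by rewrite mulr_ge0//; lra.
lra.
Qed.

Lemma total_gap_le theta eta kappa c s : (0 < c)%N -> 0 < eta ->
  0 <= theta <= kappa ->
  (forall i y, window_fun_ext (U i) y \is a fin_num ->
  [/\ window_gap i y <= 0,
      window_gap i y <= - kappa * (y - window_target i - eta) &
      eta <= `|y - window_target i| ->
      window_gap i y <= - kappa * `|y - window_target i|]) ->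
  total_gap c s <= theta * c%:R * drift_bound eta - theta * population s.
Proof.
move=> c0 eta0 /andP[th0 thk] H.
have := @total_gap_split theta eta c s (fun=> 0) c0 th0 _ eta0.
rewrite big1// mulr0 add0r; apply=> i /=.
have [h1 h2 _] := H i _ (scaled_arg_fin s i c0).
move: h1 h2; set y := scaled_arg _ _ _; set G := window_gap _ _ => h1 h2.
have [yx|yx] := leP eta (y - window_target i); nra.
Qed.

(** Half of the slope [kappa] at the far window yields the extra term; the other half still
    dominates [theta]. *)
Lemma total_gap_le_far theta eta kappa c s i0 : (0 < c)%N -> 0 < eta ->
  0 <= theta <= kappa / 2 ->
  (forall i y, window_fun_ext (U i) y \is a fin_num ->
  [/\ window_gap i y <= 0,
      window_gap i y <= - kappa * (y - window_target i - eta) &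
      eta <= `|y - window_target i| ->
      window_gap i y <= - kappa * `|y - window_target i|]) ->
  eta <= `|scaled_arg c (d i0 c) (wcount N (sval s) i0) - window_target i0| ->
  total_gap c s <= - (kappa * eta / 2) * c%:R
    + theta * c%:R * drift_bound eta - theta * population s.
Proof.
move=> c0 eta0 /andP[th0 thk] H far.
have := @total_gap_split theta eta c s
  (fun i => if i == i0 then - (kappa * eta / 2) else 0) c0 th0 _ eta0.
rewrite -big_mkcond big_pred1_eq [c%:R * - _]mulrC; apply=> i /=.
have [h1 h2 h3] := H i _ (scaled_arg_fin s i c0).
have [ii0|_] := eqVneq i i0.
  rewrite ii0 in h3 *; have {}h3 := h3 far.
  have ny := ler_norm (scaled_arg c (d i0 c) (wcount N (sval s) i0) - window_target i0).
  move: far h3 ny; set y := scaled_arg _ _ _; set G := window_gap _ _.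
  move: (`|y - window_target i0|) => n far h3 ny.
  have q1 : 0 <= (kappa / 2 - theta) * (n - eta) by rewrite mulr_ge0; lra.
  have q2 : 0 <= theta * (n - (y - window_target i0)) by rewrite mulr_ge0; lra.
  have q3 : 0 <= kappa * n by rewrite mulr_ge0; lra.
  lra.
move: h1 h2 h3; set y := scaled_arg _ _ _; set G := window_gap _ _ => h1 h2 h3.
have [yx|yx] := leP eta (y - window_target i); nra.
Qed.

(** The scale [peak_weight] is also that of the lower bound on the normalising constant, so the two
    bounds can be divided. *)
Definition peak_small (A : nat -> set (state N)) : Prop :=
  exists delta K c0, [/\ 0 < delta, 0 <= K & forall c, (c0 <= c)%N -> (0 < c)%N ->
    (\esum_(s in A c) (scaled_weight c s)%:E <=
      (peak_weight c * (K * expR (- delta * c%:R)))%:E)%E].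

Lemma eventually_natmul (a b : R) : 0 < b ->
  exists c0, forall c, (c0 <= c)%N -> a <= b * c%:R.
Proof.
move=> b0; exists (Num.trunc (`|a| / b)).+1 => c hc.
rewrite -ler_pdivrMl//; apply: (@le_trans _ _ (`|a| / b)).
  by rewrite mulrC ler_wpM2r ?ler_norm// invr_ge0 ltW.
have /andP[_ h] := truncn_itv (divr_ge0 (normr_ge0 a) (ltW b0)).
by apply: le_trans (ltW h) _; rewrite ler_nat.
Qed.

Lemma peak_small_bigcup (E : finType) (A : E -> nat -> set (state N)) :
  (forall e, peak_small (A e)) ->
  peak_small (fun c => \bigcup_(e in [set: E]) A e c).
Proof.
move=> H.
have /choice[f Hf] : forall e, exists x : R * R * nat, [/\ 0 < x.1.1, 0 <= x.1.2 &
    forall c, (x.2 <= c)%N -> (0 < c)%N ->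
    (\esum_(s in A e c) (scaled_weight c s)%:E <=
      (peak_weight c * (x.1.2 * expR (- x.1.1 * c%:R)))%:E)%E].
  by move=> e; have [de [K [c0 h]]] := H e; exists (de, K, c0).
have H1 : \forall t \near 0^'+, forall e, t <= (f e).1.1.
  by apply: filter_forall => e; apply: nbhs_right_ltW; have [] := Hf e.
near (0 : R)^'+ => t.
have t0 : 0 < t by near: t; exact: nbhs_right_gt.
have tK : forall e, t <= (f e).1.1 by near: t.
exists t, (\sum_e (f e).1.2), (\max_e (f e).2)%N; split => //.
  by apply: sumr_ge0 => e _; have [] := Hf e.
move=> c hc c0.
apply: (@le_trans _ _ (\sum_e \esum_(s in A e c) (scaled_weight c s)%:E)%E).
  under eq_bigr do rewrite esum_mkcond.
  rewrite -esum_sum; last first.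
    by move=> s e _ _; case: ifP => // _; rewrite lee_fin ltW// weight_gt0.
  rewrite esum_mkcond; apply: le_esum => s _.
  have nn e : (0 <= if s \in A e c then (scaled_weight c s)%:E else 0)%E.
    by case: ifP => // _; rewrite lee_fin ltW// weight_gt0.
  case: ifPn => [|_]; last exact: sume_ge0.
  rewrite inE => -[e _ Ae]; rewrite (bigD1 e)//= ifT ?inE//.
  by rewrite leeDl// sume_ge0.
rewrite mulr_suml mulr_sumr -sumEFin; apply: lee_sum => e _.
have [d0 K0 h] := Hf e; apply: le_trans (h c _ c0) _.
  by apply: leq_trans hc; exact: leq_bigmax.
rewrite lee_fin ler_wpM2l ?expR_ge0// ler_wpM2l// ler_expR.
by rewrite !mulNr lerN2 ler_wpM2r.
Unshelve. all: by end_near. Qed.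

Lemma expR_tilt_lt1 (t : R) : 0 < t -> 0 <= expR (- t) < 1.
Proof. by move=> t0; rewrite expR_ge0 /= expR_lt1 oppr_lt0. Qed.

Lemma const_tilt_sum theta j :
  \sum_(i | j \in route N i) load_fraction j i * expR (- theta) <= expR (- theta).
Proof.
by rewrite -mulr_suml ler_piMl ?expR_ge0// load_fraction_sum_le1.
Qed.

Lemma const_tilt theta s :
  \sum_j \sum_(i <- word s j) - theta = - theta * population s.
Proof.
rewrite /population mulr_sumr; apply: eq_bigr => j _.
by rewrite sum_const_word mulrC.
Qed.

Lemma scaled_weight_summable c : (0 < c)%N ->
  exists Z : R, (\esum_(s in [set: state N]) (scaled_weight c s)%:E = Z%:E)%E.
Proof.
move=> c0; have [kappa k0 H] := gap_bounds ltr01.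
have h := @event_bound c [set: state N] (fun _ _ => - kappa)
  (kappa * c%:R * drift_bound 1) (expR (- kappa)) c0 (expR_tilt_lt1 k0) _
  (const_tilt_sum kappa).
exists (fine (\esum_(s in [set: state N]) (scaled_weight c s)%:E)).
rewrite fineK// ge0_fin_numE; last first.
  by apply: esum_ge0 => s _; rewrite lee_fin ltW// weight_gt0.
apply: le_lt_trans (h _) (ltry _) => s _.
rewrite const_tilt; apply: le_trans (total_gap_le s c0 ltr01 _ H) _.
  by rewrite ltW/=.
by rewrite mulNr.
Qed.

Definition window_event (eta : R) i c : set (state N) :=
  [set s | 2 * eta <= `|(wcount N (sval s) i)%:R / c%:R - window_target i|].

Lemma window_event_small eta i : 0 < eta -> peak_small (window_event eta i).
Proof.
move=> eta0; have [kappa k0 H] := gap_bounds eta0.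
(* The factor 2 in [window_event] leaves room for the shift [d i c / c], at most [eta] from [c0]
   on. *)
have [c0 Hc0] := eventually_natmul (D i) eta0.
pose B := drift_bound eta.
have B0 : 0 <= B := drift_bound_ge0 eta0.
(* The second bound keeps the drift [theta * c * B] below half of the gain [kappa * eta / 2 * c]. *)
pose theta := Num.min (kappa / 2) (kappa * eta / 4 / (B + 1)).
have th0 : 0 < theta by rewrite lt_min !divr_gt0// ?mulr_gt0// ltr_wpDl.
have thk : theta <= kappa / 2 by rewrite ge_min lexx.
have thB : theta * (B + 1) <= kappa * eta / 4.
  by rewrite -ler_pdivlMr ?ltr_wpDl// ge_min lexx orbT.
have /andP[r0 r1] := expR_tilt_lt1 th0.
exists (kappa * eta / 4), ((1 - expR (- theta))^-1 ^+ #|J|), c0; split.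
- by rewrite divr_gt0// mulr_gt0.
- by rewrite exprn_ge0// invr_ge0 subr_ge0 ltW.
move=> c hc cp; rewrite [X in peak_weight c * X]mulrC.
apply: (@event_bound c _ (fun _ _ => - theta) _ (expR (- theta)) cp _ _
  (const_tilt_sum theta)); first exact: expR_tilt_lt1.
move=> s far; have th01 : 0 <= theta <= kappa / 2 by rewrite ltW.
have c1 : 0 < c%:R :> R by rewrite ltr0n.
have far' : eta <= `|scaled_arg c (d i c) (wcount N (sval s) i) - window_target i|.
  have dc : `|d i c / c%:R| <= eta.
    rewrite normrM normfV (gtr0_norm c1) ler_pdivrMr//.
    exact: le_trans (HD i cp) (Hc0 c hc).
  have := ler_normB (scaled_arg c (d i c) (wcount N (sval s) i) - window_target i)
    (d i c / c%:R).
  rewrite /scaled_arg addrAC addrK; move: far; rewrite /window_event /=; lra.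
apply: le_trans (total_gap_le_far cp eta0 th01 H far') _.
rewrite const_tilt -/B.
have : 0 <= (kappa * eta / 4 - theta * (B + 1)) * c%:R by rewrite mulr_ge0; lra.
have : 0 <= theta * c%:R by rewrite mulr_ge0// ltW.
lra.
Qed.

(** The length [n] is a parameter: upper bounds use the actual queue length, the lower bound uses
    the typical one. *)
Definition count_deviation (n : R) (e : J * I) s : R :=
  (count_mem e.2 (word s e.1))%:R - n * load_fraction e.1 e.2.

Definition count_event (eta : R) (b : bool) (e : J * I) c : set (state N) :=
  [set s | eta * c%:R <= (-1) ^+ b * count_deviation (size (word s e.1))%:R e s].

Lemma normr_signed (b : bool) (t : R) : `|(-1) ^+ b * t| = `|t|.
Proof. by rewrite normrM normrX normrN normr1 expr1n mul1r. Qed.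

Lemma tilt_sum_le theta (b : bool) (e : J * I) t j : 0 <= t <= 2^-1 ->
  e.1 \in route N e.2 ->
  \sum_(i | j \in route N i) load_fraction j i * expR (- theta +
      (if j == e.1 then (-1) ^+ b * t * ((i == e.2)%:R - load_fraction e.1 e.2) else 0))
    <= expR (- theta) * (if j == e.1 then expR (2 * t ^+ 2) else 1).
Proof.
move=> /andP[t0 t2] er.
under eq_bigr do rewrite expRD mulrCA; rewrite -mulr_sumr ler_wpM2l ?expR_ge0//.
case: eqP => [->|_].
  have -> : t ^+ 2 = ((-1) ^+ b * t) ^+ 2 by rewrite exprMn sqrr_sign mul1r.
  apply: (@chernoff_factor R I (fun i => e.1 \in route N i)) => //.
  - by move=> i; exact: load_fraction_ge0.
  - exact: load_fraction_sum_le1.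
  - by rewrite normr_signed ger0_norm.
under eq_bigr do rewrite expR0 mulr1; exact: load_fraction_sum_le1.
Qed.

Lemma count_event_small eta b e : 0 < eta -> e.1 \in route N e.2 ->
  peak_small (count_event eta b e).
Proof.
move=> eta0 er; have [kappa k0 H] := gap_bounds eta0.
pose B := drift_bound eta.
have B0 : 0 <= B := drift_bound_ge0 eta0.
(* A tilt [t] gains [t * eta * c] and costs [2 * t ^+ 2] per packet; a decay of [3 * t ^+ 2] per
   packet covers the cost and leaves the ratio [expR (- t ^+ 2)]. The bound [kappa / 3] makes this
   decay available, and [eta / 6 / (B + 1)] keeps its drift below half of the gain. *)
pose t := Num.min (2^-1) (Num.min (kappa / 3) (eta / 6 / (B + 1))).
have t0 : 0 < t by rewrite !lt_min invr_gt0 ltr0n !divr_gt0// ltr_wpDl.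
have t2 : t <= 2^-1 by rewrite ge_min lexx.
have tk : t <= kappa / 3 by rewrite !ge_min lexx !orbT.
have tB : t * (B + 1) <= eta / 6.
  by rewrite -ler_pdivlMr ?ltr_wpDl// !ge_min lexx !orbT.
have tt0 : 0 < t ^+ 2 by rewrite exprn_gt0.
have /andP[r0 r1] := expR_tilt_lt1 tt0.
exists (t * eta / 2), ((1 - expR (- t ^+ 2))^-1 ^+ #|J|), 0%N; split.
- by rewrite divr_gt0// mulr_gt0.
- by rewrite exprn_ge0// invr_ge0 subr_ge0 ltW.
move=> c _ cp; rewrite [X in peak_weight c * X]mulrC.
have c1 : 0 < c%:R :> R by rewrite ltr0n.
pose theta := 3 * t ^+ 2.
apply: (@event_bound c _ (fun j i => - theta +
    (if j == e.1 then (-1) ^+ b * t * ((i == e.2)%:R - load_fraction e.1 e.2) else 0))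
   _ (expR (- t ^+ 2)) cp).
- exact: expR_tilt_lt1.
- move=> s far; rewrite sum_tilt.
  have thk : 0 <= theta <= kappa.
    apply/andP; split; first by rewrite /theta; lra.
    rewrite /theta expr2; nra.
  apply: le_trans (total_gap_le s cp eta0 thk H) _.
  move: far; rewrite /count_event /= /count_deviation -/B -/(population s) => far.
  have : t * (eta * c%:R) <= (-1) ^+ b * t *
     ((count_mem e.2 (word s e.1))%:R
        - (size (word s e.1))%:R * load_fraction e.1 e.2).
    by rewrite [_ ^+ b * t]mulrC -mulrA ler_pM2l.
  rewrite -/(population s).
  have : 0 <= (eta / 6 - t * (B + 1)) * (t * c%:R).
    by apply: mulr_ge0; [lra|exact/ltW/mulr_gt0].
  have : 0 <= t ^+ 2 * c%:R by apply: mulr_ge0; exact: ltW.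
  rewrite /theta expr2 /word; lra.
- move=> j; apply: le_trans (tilt_sum_le theta b j _ er) _; first by rewrite ltW.
  rewrite /theta; case: ifP => _; first by rewrite -expRD ler_expR; lra.
  by rewrite mulr1 ler_expR; lra.
Qed.

(** * Lower bound on the normalising constant *)

Section LowerBound.
Variable q : J -> R.
Hypothesis q_ge0 : forall j, 0 <= q j.
Hypothesis q_sat : forall j, q j != 0 -> saturated N L j.
Hypothesis q_grad : forall i, (U i)^`()%classic (L i) = \sum_(j | j \in route N i) q j.

(* A queue with [q j != 0] is saturated, so its load fractions are a probability
   vector; the other queues are empty in the typical states. *)
Definition typical_length c j : nat := Num.trunc (c%:R * (q j * cap N j)).

Let typical_ge0 c j : 0 <= c%:R * (q j * cap N j).
Proof. by rewrite !mulr_ge0// ltW// cap_gt0. Qed.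

Lemma typical_length_itv c j :
  (typical_length c j)%:R <= c%:R * (q j * cap N j) < (typical_length c j)%:R + 1.
Proof. by have := truncn_itv (typical_ge0 c j); rewrite natr1. Qed.

Definition has_typical_length c s : bool :=
  [forall j, size (word s j) == typical_length c j].

Lemma typical_fraction_sum c j :
  (\sum_(i | j \in route N i) load_fraction j i) ^+ typical_length c j = 1.
Proof.
have [q0|qn0] := eqVneq (q j) 0.
  by rewrite /typical_length q0 mul0r mulr0 truncn0 expr0.
rewrite /load_fraction -mulr_suml (eqP (q_sat qn0)) divff ?expr1n//.
by rewrite gt_eqF// cap_gt0.
Qed.

Lemma typical_mass c : has_esum
  (fun s => if has_typical_length c s then word_prod load_fraction (sval s) else 0) 1.
Proof.
have := word_prod_size N load_fraction_ge0 (typical_length c); apply: eq_has_esum => //.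
by rewrite big1// => j _; exact: typical_fraction_sum.
Qed.

Definition capacity_price : R := \sum_j q j * cap N j.

Lemma typical_length_le c j : (typical_length c j)%:R <= c%:R * capacity_price.
Proof.
have /andP[h _] := typical_length_itv c j; apply: le_trans h _.
rewrite ler_wpM2l// /capacity_price (bigD1 j)//= lerDl sumr_ge0// => k _.
by rewrite mulr_ge0// ltW// cap_gt0.
Qed.

(** A Chernoff bound at prescribed lengths: the sum over words is finite, so the tilt is applied
    with decay 0, and [typical_length_le] bounds its second-order cost. *)
Lemma atypical_mass c eta t (b : bool) (e : J * I) : e.1 \in route N e.2 -> 0 <= t <= 2^-1 ->
  (\esum_(s in [set: state N])
    (if has_typical_length c s &&
        (eta * c%:R <= (-1) ^+ b * count_deviation (typical_length c e.1)%:R e s)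
     then word_prod load_fraction (sval s) else 0)%:E <=
   (expR ((2 * t ^+ 2 * capacity_price - t * eta) * c%:R))%:E)%E.
Proof.
move=> er t02; have /andP[t0 t2] := t02.
pose a j i := load_fraction j i * expR (- 0 +
  (if j == e.1 then (-1) ^+ b * t * ((i == e.2)%:R - load_fraction e.1 e.2) else 0)).
have a0 j i : 0 <= a j i by rewrite mulr_ge0 ?load_fraction_ge0 ?expR_ge0.
have [f0 fv] := word_prod_size N a0 (typical_length c).
apply: (@le_trans _ _ (\esum_(s in [set: state N]) (expR (- (t * (eta * c%:R))) *
   (if has_typical_length c s then word_prod a (sval s) else 0))%:E)%E).
  apply: le_esum => s _; rewrite lee_fin.
  have W0 := word_prod_ge0 load_fraction_ge0 (sval s).
  case: ifPn => [/andP[sn dev]|_]; last first.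
    by rewrite mulr_ge0 ?expR_ge0//; case: ifP => // _; exact: word_prod_ge0.
  rewrite sn word_prod_tilt sum_tilt oppr0 mul0r add0r mulrCA -expRD ler_peMr//.
  rewrite -[leLHS]expR0 ler_expR addrC subr_ge0 [_ ^+ b * t]mulrC -mulrA ler_wpM2l//.
  have -> : size (sval s e.1) = typical_length c e.1 by exact/eqP/(forallP sn).
  exact: dev.
rewrite esumZl ?expR_ge0//.
rewrite fv -EFinM lee_fin.
have -> : expR ((2 * t ^+ 2 * capacity_price - t * eta) * c%:R) =
    expR (- (t * (eta * c%:R))) * expR (2 * t ^+ 2 * (c%:R * capacity_price)).
  by rewrite -expRD; congr expR; ring.
rewrite ler_wpM2l ?expR_ge0//.
apply: (@le_trans _ _ (\prod_j (if j == e.1 then expR (2 * t ^+ 2) else 1) ^+ typical_length c j)).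
  apply: ler_prod => j _; rewrite exprn_ge0 ?sumr_ge0//=.
  apply: lerXn2r; rewrite ?nnegrE; first exact: sumr_ge0.
    by case: ifP => // _; exact: expR_ge0.
  have := @tilt_sum_le 0 b e t j t02 er.
  by rewrite oppr0 expR0 mul1r /a oppr0.
rewrite (bigD1 e.1)//= eqxx big1 ?mulr1 => [|j /negbTE ->]; last by rewrite expr1n.
rewrite -expRM_natl ler_expR mulrC ler_wpM2l ?typical_length_le//.
by rewrite mulr_ge0// exprn_ge0.
Qed.

Definition is_balanced c eta s : bool :=
  [forall k : incidence N * bool, (-1) ^+ k.2 *
     count_deviation (typical_length c (sval k.1).1)%:R (sval k.1) s < eta * c%:R].

(** The additional 1 is the rounding in [typical_length], multiplied by a load fraction at most
    1. *)
Lemma balanced_count c eta s j i : is_balanced c eta s -> j \in route N i ->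
  `|(count_mem i (word s j))%:R - c%:R * (q j * L i)| <= eta * c%:R + 1.
Proof.
move=> /forallP sb ji.
pose e : incidence N := exist (fun p : J * I => p.1 \in route N p.2 : Prop) (j, i) ji.
have := sb (e, true); have := sb (e, false); rewrite /= expr0 expr1 mul1r mulN1r.
rewrite /count_deviation /= => h1 h2.
have /andP[n1 n2] := typical_length_itv c j.
have C0 := cap_gt0 N j.
have -> : c%:R * (q j * L i) = c%:R * (q j * cap N j) * load_fraction j i.
  by rewrite /load_fraction; field; rewrite gt_eqF.
have f0 := load_fraction_ge0 j i.
have f1 : load_fraction j i <= 1.
  apply: le_trans (load_fraction_sum_le1 j).
  by rewrite (bigD1 i)//= lerDl sumr_ge0// => k _; exact: load_fraction_ge0.
move: h1 h2 n1 n2 f0 f1; set C := c%:R * (q j * _); set n := (typical_length _ _)%:R.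
set f := load_fraction _ _; set k := (count_mem _ _)%:R => h1 h2 n1 n2 f0 f1.
have p1 : 0 <= (C - n) * f by rewrite mulr_ge0// subr_ge0.
have p2 : (C - n) * f <= 1 by rewrite mulr_ile1// ?subr_ge0//; lra.
by apply/ler_normlP; split; lra.
Qed.

(** Summing [q j * L i] along the route gives [L i] times the utility's slope by [q_grad]: this is
    where the prices produce the window target. *)
Lemma balanced_window c eta s i : 0 < eta -> is_balanced c eta s ->
  `|(wcount N (sval s) i)%:R - c%:R * window_target i| <= #|J|%:R * (eta * c%:R + 1).
Proof.
move=> eta0 sb; rewrite /wcount /window_target q_grad natr_sum.
have -> : c%:R * (L i * \sum_(j | j \in route N i) q j) =
    \sum_(j | j \in route N i) c%:R * (q j * L i).
  by rewrite -mulr_sumr -mulr_suml [L i * _]mulrC.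
rewrite -sumrB; apply: le_trans (ler_norm_sum _ _ _) _.
apply: (@le_trans _ _ (\sum_(j | j \in route N i) (eta * c%:R + 1))).
  by apply: ler_sum => j ji; exact: balanced_count.
rewrite sumr_const -(mulr_natl (_ + _)) ler_wpM2r ?ler_nat ?max_card//.
by rewrite addr_ge0// mulr_ge0// ltW.
Qed.

Lemma balanced_gap eps : 0 < eps -> exists eta c0, 0 < eta /\
  forall c s, (c0 <= c)%N -> (0 < c)%N -> is_balanced c eta s ->
    - eps * c%:R <= total_gap c s.
Proof.
move=> eps0; pose eps' := eps / (#|I|%:R + 1).
have eps'0 : 0 < eps' by rewrite divr_gt0// ltr_wpDl.
have /choice[K HK] : forall i, exists r, 0 < r /\
    forall y, `|y - window_target i| < r -> - eps' <= window_gap i y.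
  move=> i; have [r r0 H] := window_gap_continuous (HU i) (HA1 i) (HA2 i) (L0 i) eps'0.
  by exists r.
have H : \forall t \near 0^'+, forall i, t <= K i.
  by apply: filter_forall => i; apply: nbhs_right_ltW; exact: (HK i).1.
near (0 : R)^'+ => r.
have r0 : 0 < r by near: r; exact: nbhs_right_gt.
have rK : forall i, r <= K i by near: r.
have J0 : 0 <= #|J|%:R :> R by [].
(* A quarter of the radius [r] is reserved for the deviations at no more than [#|J|] queues, and
   half for the rounding and the shift [d i c]. *)
pose eta := r / 4 / (#|J|%:R + 1).
have eta0 : 0 < eta by rewrite !divr_gt0// ltr_wpDl.
have etaE : eta * (#|J|%:R + 1) = r / 4 by rewrite divfK// gt_eqF// ltr_wpDl.
have r2 : 0 < r / 2 by rewrite divr_gt0.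
have [c0 Hc0] := eventually_natmul (#|J|%:R + \sum_i D i) r2.
exists eta, c0; split => // c s hc cp sb.
have c1 : 0 < c%:R :> R by rewrite ltr0n.
have gapi i : - eps' <= window_gap i (scaled_arg c (d i c) (wcount N (sval s) i)).
  apply: (HK i).2; apply: lt_le_trans (rK i).
  rewrite -(ltr_pM2l c1) -[X in X * `|_|](gtr0_norm c1) -normrM mulrBr scaled_argE//.
  rewrite addrAC; apply: le_lt_trans (ler_normD _ _) _.
  have h1 := balanced_window i eta0 sb; have h2 := HD i cp; have h3 := Hc0 c hc.
  have h4 : D i <= \sum_i D i.
    by rewrite (bigD1 i)//= lerDl sumr_ge0// => k _; exact: D_ge0.
  have h5 : eta * (#|J|%:R + 1) * c%:R = r / 4 * c%:R by rewrite etaE.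
  have h6 : 0 < eta * c%:R by rewrite mulr_gt0.
  have h7 : 0 < r * c%:R by rewrite mulr_gt0.
  lra.
rewrite /total_gap; apply: (@le_trans _ _ (\sum_(i : I) c%:R * - eps')); last first.
  by apply: ler_sum => i _; rewrite ler_pM2l.
rewrite sumr_const -(mulr_natl (_ * _)).
have -> : #|I|%:R * (c%:R * - eps') = - (#|I|%:R * eps') * c%:R by ring.
rewrite ler_pM2r// lerN2.
have : eps' * (#|I|%:R + 1) = eps by rewrite divfK// gt_eqF// ltr_wpDl.
by lra.
Unshelve. all: by end_near. Qed.

(** A union bound over incidences and signs: unbalanced states take at most half of the unit mass,
    and a factor one half does not change exponential rates. *)
Lemma balanced_mass eta : 0 < eta -> exists c0, forall c, (c0 <= c)%N ->
  ((2^-1)%:E <= \esum_(s in [set: state N])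
    (if has_typical_length c s && is_balanced c eta s
     then word_prod load_fraction (sval s) else 0)%:E)%E.
Proof.
move=> eta0; have Q0 : 0 <= capacity_price.
  by apply: sumr_ge0 => j _; rewrite mulr_ge0// ltW// cap_gt0.
pose t := Num.min (2^-1) (eta / 4 / (capacity_price + 1)).
have t0 : 0 < t by rewrite !lt_min invr_gt0 ltr0n !divr_gt0// ltr_wpDl.
have t2 : t <= 2^-1 by rewrite ge_min lexx.
have tB : t * (capacity_price + 1) <= eta / 4.
  by rewrite -ler_pdivlMr ?ltr_wpDl// !ge_min lexx !orbT.
pose K : R := #|{: incidence N * bool}|%:R.
have te : 0 < t * eta / 2 by rewrite divr_gt0// mulr_gt0.
(* As [1 + a <= expR a], bounding [2 * K] by the exponent brings the union bound below one half. *)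
have [c0 Hc0] := eventually_natmul (2 * K) te.
exists c0 => c hc.
set M := \esum_(s in _) _.
pose bad (k : incidence N * bool) s := eta * c%:R <=
  (-1) ^+ k.2 * count_deviation (typical_length c (sval k.1).1)%:R (sval k.1) s.
have W0 s := word_prod_ge0 load_fraction_ge0 (sval s).
have badM k : (\esum_(s in [set: state N]) (if has_typical_length c s && bad k s
   then word_prod load_fraction (sval s) else 0)%:E <=
   (expR (- (t * eta / 2 * c%:R)))%:E)%E.
  have t02 : 0 <= t <= 2^-1 by rewrite t2 ltW.
  apply: le_trans (@atypical_mass c eta t k.2 (sval k.1) (valP k.1) t02) _.
  rewrite lee_fin ler_expR -[leRHS]mulNr ler_wpM2r//.
  have : 0 <= (eta / 4 - t * (capacity_price + 1)) * t by rewrite mulr_ge0 ?subr_ge0// ltW.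
  have : 0 <= t ^+ 2 by rewrite exprn_ge0// ltW.
  rewrite expr2; lra.
have [_ mass1] := typical_mass c.
have : (1%:E <= M + \sum_(k : incidence N * bool)
    \esum_(s in [set: state N]) (if has_typical_length c s && bad k s
   then word_prod load_fraction (sval s) else 0)%:E)%E.
  rewrite -esum_sum; last by move=> s k _ _; rewrite lee_fin; case: ifP.
  rewrite -mass1 /M -esumD; last 2 first.
  - by move=> s _; rewrite lee_fin; case: ifP.
  - by move=> s _; apply: sume_ge0 => k _; rewrite lee_fin; case: ifP.
  apply: le_esum => s _; case: ifPn => sn /=; last first.
    by rewrite adde_ge0// sume_ge0.
  case: ifPn => sb; first by rewrite leeDl// sume_ge0// => k _; rewrite lee_fin; case: ifP.
  move: sb => /forallPn[k]; rewrite -leNgt => bk.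
  rewrite (bigD1 k)//= /bad bk add0e leeDl// sume_ge0// => k' _.
  by rewrite lee_fin; case: ifP.
move=> h; have : (1%:E <= M + (2^-1)%:E)%E.
  apply: le_trans h _; rewrite leeD2l//.
  apply: (@le_trans _ _ (\sum_(k : incidence N * bool)
    (expR (- (t * eta / 2 * c%:R)))%:E)%E); first by apply: lee_sum.
  rewrite sumEFin sumr_const lee_fin -(mulr_natl (expR _)) -/K.
  have := Hc0 c hc; have := expR_ge1Dx (t * eta / 2 * c%:R).
  have := expRxMexpNx_1 (t * eta / 2 * c%:R).
  have := expR_gt0 (- (t * eta / 2 * c%:R)).
  set E := expR (_ / 2 * _); set E' := expR (- _) => E'0 EE h1 h2.
  have : 0 <= (E - 2 * K) * E' by rewrite mulr_ge0 ?ltW//; lra.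
  by rewrite mulrBl EE; lra.
rewrite -leeBlDr// => hM; apply: le_trans hM.
by rewrite -EFinB lee_fin; lra.
Qed.

Lemma partition_lower_bound_of_multipliers eps : 0 < eps ->
  exists c0, forall c, (c0 <= c)%N -> (0 < c)%N ->
  ((peak_weight c * (expR (- eps * c%:R) / 2))%:E <=
    \esum_(s in [set: state N]) (scaled_weight c s)%:E)%E.
Proof.
move=> eps0; have [eta [c1 [eta0 Hgap]]] := balanced_gap eps0.
have [c2 Hmass] := balanced_mass eta0.
exists (maxn c1 c2) => c; rewrite geq_max => /andP[hc1 hc2] cp.
have C0 : 0 <= peak_weight c * expR (- eps * c%:R) by rewrite mulr_ge0 ?expR_ge0.
have W0 s := word_prod_ge0 load_fraction_ge0 (sval s).
rewrite mulrA EFinM.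
apply: le_trans (lee_wpmul2l _ (Hmass c hc2)) _; first by rewrite lee_fin.
rewrite -esumZl//; last by move=> s; case: ifP.
apply: le_esum => s _; rewrite lee_fin; case: ifPn => [/andP[_ sb]|_]; last first.
  by rewrite mulr0 ltW// weight_gt0.
rewrite scaled_weightE// -mulrA ler_wpM2l ?expR_ge0// ler_wpM2r// ler_expR.
exact: Hgap.
Qed.

End LowerBound.

Lemma partition_lower_bound eps : 0 < eps ->
  exists c0, forall c, (c0 <= c)%N -> (0 < c)%N ->
  ((peak_weight c * (expR (- eps * c%:R) / 2))%:E <=
    \esum_(s in [set: state N]) (scaled_weight c s)%:E)%E.
Proof.
have [q [q0 qs qg]] := multipliers_exist HU Lopt.
exact: partition_lower_bound_of_multipliers.
Qed.

(** * Vanishing probability of being far from the limit set *)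

Lemma limit_set_of_residuals (m : {ffun incidence N -> R}) :
  (forall k, 0 <= m k) -> (forall k, balance_residual L m k = 0) ->
  (forall i, window_residual window_target m i = 0) -> limit_set N U L m.
Proof.
move=> m0 b0 w0; split => // [k|i].
  by apply/eqP; rewrite -subr_eq0; apply/eqP; exact: b0.
have -> : window_total m i = window_target i.
  by apply/eqP; rewrite -subr_eq0; apply/eqP; exact: w0.
by split; [exact: x_gt0|exact: derive1_window_target].
Qed.

Definition scaled_count c s : {ffun incidence N -> R} :=
  [ffun k => (count_vector s k / c%:R)%R].

(** Centring the counts at [load_fraction] makes the balance residual a multiple of the deviation
    that the Chernoff bound controls. *)
Lemma balance_residual_scaled c s (k : incidence N) :
  balance_residual L (scaled_count c s) k =
  cap N (sval k).1 / c%:R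
    * count_deviation (size (word s (sval k).1))%:R (sval k) s.
Proof.
rewrite /balance_residual /queue_total.
rewrite (eq_bigr (fun k => (fun j i => (count_mem i (word s j))%:R / c%:R)
   (sval k).1 (sval k).2)); last by move=> k' _; rewrite !ffunE.
rewrite (@sum_incidence_queue _ _ _ N _ (fun j i => (count_mem i (word s j))%:R / c%:R)).
rewrite -mulr_suml -size_word_sum !ffunE.
rewrite /queue_route_count /count_deviation /load_fraction.
set n := (count_mem _ _)%:R; set z := (size _)%:R; set l := L _.
have C0 : cap N (sval k).1 != 0 by rewrite gt_eqF// cap_gt0.
by move: (c%:R^-1) => r; field.
Qed.

Lemma window_residual_scaled c s i :
  window_residual window_target (scaled_count c s) i =
  (wcount N (sval s) i)%:R / c%:R - window_target i.
Proof.
rewrite /window_residual /window_total.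
rewrite (eq_bigr (fun k => (fun j i => (count_mem i (word s j))%:R / c%:R)
   (sval k).1 (sval k).2)); last by move=> k' _; rewrite !ffunE.
rewrite (@sum_incidence_window _ _ _ N _ (fun j i => (count_mem i (word s j))%:R / c%:R)).
by rewrite -mulr_suml -natr_sum.
Qed.

Definition far_event (eps : R) c : set (state N) :=
  [set s | (eps%:E <= dist_to (limit_set N U L) (scaled_count c s))%E].

Lemma far_event_small eps : 0 < eps -> peak_small (far_event eps).
Proof.
move=> eps0.
have [eta eta0 Hdist] := dist_lt_of_residuals limit_set_of_residuals eps0.
pose C := \sum_j cap N j.
have C0 : 0 <= C by apply: sumr_ge0 => j _; exact/ltW/cap_gt0.
(* The balance residual carries the capacity of its queue as a factor, which is at most [C]. *)
pose eta2 := eta / (C + 1).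
have eta20 : 0 < eta2 by rewrite divr_gt0// ltr_wpDl.
pose A (e : I + incidence N * bool) : nat -> set (state N) := match e with
  | inl i => window_event (eta / 2) i
  | inr (k, b) => count_event eta2 b (sval k)
  end.
have [|delta [K [c0 [d0 K0 H]]]] := @peak_small_bigcup _ A.
  case=> [i|[k b]]; first by apply: window_event_small; rewrite divr_gt0.
  by apply: count_event_small => //; exact: (valP k).
exists delta, K, c0; split => // c hc cp; apply: le_trans (H c hc cp).
apply: esum_subset => s /= far; apply: contrapT => nA.
have c1 : 0 < c%:R :> R by rewrite ltr0n.
move: far; rewrite /far_event /= leNgt => /negP; apply; apply: Hdist.
- by move=> k; rewrite !ffunE divr_ge0.
- move=> k; rewrite balance_residual_scaled leNgt; apply/negP => lt.
  set dev := count_deviation _ _ _ in lt.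
  have Cj := cap_gt0 N (sval k).1.
  have CjC : cap N (sval k).1 <= C.
    by rewrite /C (bigD1 (sval k).1)//= lerDl sumr_ge0// => j _; exact/ltW/cap_gt0.
  have : eta2 * c%:R <= `|dev|.
    move: lt; rewrite normrM ger0_norm ?divr_ge0 ?(ltW Cj)// mulrAC ltr_pdivlMr// => lt.
    rewrite /eta2 mulrAC ler_pdivrMr ?ltr_wpDl//; apply: le_trans (ltW lt) _.
    by rewrite mulrC ler_wpM2l//; lra.
  have [d1|d1] := leP 0 dev.
    rewrite ger0_norm// => h; apply: nA; exists (inr (k, false)) => //=.
    by rewrite /count_event /= expr0 mul1r.
  rewrite ltr0_norm// => h; apply: nA; exists (inr (k, true)) => //=.
  by rewrite /count_event /= expr1 mulN1r.
- move=> i; rewrite window_residual_scaled leNgt; apply/negP => lt.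
  apply: nA; exists (inl i) => //=; rewrite /window_event /=.
  by rewrite mulrC divfK// ltW.
Qed.

Lemma pmf_prob_scaled_weight c (mu : state N -> R) : (0 < c)%N ->
  is_stationary
    (queueing_rate N (fun i k => injection_fun (U i) c (d i c) k)) mu ->
  exists Z : R, [/\ 0 < Z,
    (\esum_(s in [set: state N]) (scaled_weight c s)%:E = Z%:E)%E &
    forall A, (pmf_prob mu A = Z^-1%:E * \esum_(s in A) (scaled_weight c s)%:E)%E].
Proof.
move=> cp Hmu; have [Z EZ] := scaled_weight_summable cp; exists Z.
have W0 s : 0 < scaled_weight c s by exact: weight_gt0.
have Z0 : 0 < Z.
  rewrite -lte_fin -EZ; apply: (@lt_le_trans _ _ (scaled_weight c (empty_state N))%:E).
    by rewrite lte_fin.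
  apply: (@esum_term_le _ _ setT (fun s => (scaled_weight c s)%:E)) => //.
  by rewrite lee_fin ltW.
split => // A.
have /choice[B HB] : forall i, exists B, forall k, injection_fun (U i) c (d i c) k <= B.
  by move=> i; exact: (injection_fun_bounded (HA2 i) cp (Hddef i cp)).
have B0 i : 0 <= B i by apply: le_trans (HB i 0%N); exact: expR_ge0.
have gB i k : injection_fun (U i) c (d i c) k <= \sum_i B i.
  by apply: le_trans (HB i k) _; rewrite (bigD1 i)//= lerDl sumr_ge0.
have E := @stationary_weight _ _ _ N
  (fun i k => scaled_window_fun (U i) c (d i c) k) (\sum_i B i) Z mu gB EZ Hmu.
rewrite /pmf_prob; under eq_esum => s _ do rewrite E.
by apply: esumZl => [|s]; [rewrite invr_ge0 ltW|exact/ltW/W0].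
Qed.

Lemma far_event_prob_cvg0 (mu : nat -> state N -> R) eps : 0 < eps ->
  (forall c, (0 < c)%N -> is_stationary
    (queueing_rate N (fun i k => injection_fun (U i) c (d i c) k)) (mu c)) ->
  pmf_prob (mu c) (far_event eps c) @[c --> \oo] --> 0%E.
Proof.
move=> eps0 Hmu.
have [delta [K [c1 [d0 K0 Hup]]]] := far_event_small eps0.
(* The normalising constant is allowed to lose half of the rate of the far event, so the quotient
   still decays at rate [delta / 2]. *)
have d2 : 0 < delta / 2 by rewrite divr_gt0.
have [c2 Hlow] := partition_lower_bound d2.
pose h (c : nat) := 2 * K * expR (- (delta / 2)) ^+ c.
have hcvg : (h c)%:E @[c --> \oo] --> 0%E.
  apply: cvg_EFin; first exact: nearW.
  rewrite (_ : _ \o _ = h)//.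
  have -> : (0 : R) = 2 * K * 0 by rewrite mulr0.
  apply: cvgMr; apply: cvg_expr.
  by rewrite ger0_norm ?expR_ge0// expR_lt1 oppr_lt0.
apply: (squeeze_cvge _ (cvg_cst 0%E) hcvg).
exists (maxn c1 (maxn c2 1)) => // c /=; rewrite !geq_max => /and3P[h1 h2 cp].
have [Z [Z0 EZ ->]] := pmf_prob_scaled_weight cp (Hmu c cp).
have Zi : 0 <= Z^-1 by rewrite invr_ge0 ltW.
apply/andP; split.
  rewrite mule_ge0 ?lee_fin// esum_ge0// => s _; rewrite lee_fin; exact/ltW/weight_gt0.
apply: le_trans (lee_wpmul2l _ (Hup c h1 cp)) _; first by rewrite lee_fin.
rewrite -EFinM lee_fin ler_pdivrMl//.
have := Hlow c h2 cp; rewrite EZ lee_fin => low.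
have P0 : 0 < peak_weight c by exact: expR_gt0.
have hK : 0 <= h c by rewrite !mulr_ge0 ?exprn_ge0 ?expR_ge0.
apply: le_trans (ler_wpM2r hK low).
rewrite /h -expRM_natl.
have -> : expR (- delta * c%:R) = expR (- (delta / 2) * c%:R) * expR (c%:R * - (delta / 2)).
  by rewrite -expRD; congr expR; field.
set E1 := expR _; set E2 := expR (c%:R * _).
have -> : peak_weight c * (E1 / 2) * (2 * K * E2) = peak_weight c * (K * (E1 * E2)).
  by field.
exact: lexx.
Qed.

End Concentration.

Theorem theorem5p4 (R : realType) (J I : finType) (N : network R J I)
    (U : I -> R -> R) (d : I -> nat -> R)
    (pi : nat -> state N -> R) (Lstar : I -> R)
    (HU : forall i, is_utility (U i))
    (HA1 : forall i, assumption1 (U i))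
    (HA2 : forall i, assumption2 (U i))
    (Hdbnd : forall i, exists B : R,
       forall c : nat, (0 < c)%N -> `|d i c| <= B)
    (Hddef : forall i (c : nat), (0 < c)%N ->
       scaled_window_defined (U i) c (d i c))
    (Hpi : forall c : nat, (0 < c)%N ->
       is_stationary
         (queueing_rate N (fun i k => injection_fun (U i) c (d i c) k)) (pi c))
    (Hopt : system_optimal N U Lstar) :
  forall eps : R, 0 < eps ->
    pmf_prob (pi c)
      [set s : state N | (eps%:E <= dist_to (limit_set N U Lstar)
                  [ffun k => (count_vector s k / c%:R)%R])%E] @[c --> \oo]
    --> 0%E.
Proof.
move=> eps eps0; have /choice[D HD] := Hdbnd.
exact: (far_event_prob_cvg0 HU HA1 HA2 HD Hddef Hopt eps0 Hpi).
Qed.
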